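(* Suppose that $\operatorname{char}(\mathbf{k})=p>0$ and that $\mathcal{P}$ is a polynomial functor of degree $d$. If $n-1\geq dp$ then for all $j$ \[H^j\left(\mathbb{P}^{n-1},(F^p\circ\mathcal{P})(\Omega)\right) \cong H^j\left(\mathbb{P}^{n-1},(\mathcal{P}\circ F^p)(\Omega)\right) \cong H^j\left(\mathbb{P}^{n-1},\mathcal{P}(\Omega)\right).\]
   Context: $\mathbf{k}$ is an algebraically closed field. A polynomial functor of degree $d$ is a functor $\mathcal{P}$ from finite dimensional $\mathbf{k}$-vector spaces to itself such that the maps $\operatorname{Hom}(V,W)\to\operatorname{Hom}(\mathcal{P}(V),\mathcal{P}(W))$ are polynomial and $\mathcal{P}(c\cdot\mathrm{id}_V)=c^d\cdot\mathrm{id}_{\mathcal{P}(V)}$ for all $c\in\mathbf{k}$. Such functors apply to vector bundles. The Frobenius power functor $F^p$ is the subfunctor of $\operatorname{Sym}^p$ given by $F^pV=\{v^p:v\in V\}\subset\operatorname{Sym}^pV$. $\Omega$ is the cotangent sheaf of $\mathbb{P}^{n-1}$ over $\mathbf{k}$. Isomorphisms are of $\mathbf{k}$-vector spaces. *)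

(* Defs.v *)
From HB Require Import structures.
From mathcomp Require Import all_boot all_order all_algebra.
From mathcomp Require Import boolp.
From mathcomp Require Import mpoly ring.

Set Implicit Arguments.
Unset Strict Implicit.
Unset Printing Implicit Defensive.

Import GRing.Theory VectorInternalTheory.
Local Open Scope ring_scope.

Definition lmod_iso (R : nzRingType) (U V : lmodType R) : Prop :=
  exists f : {linear U -> V}, bijective f.

Section LmodQuotient.
Variables (R : nzRingType) (V : lmodType R) (B0 : {pred V}).
Hypothesis B0_submod : submod_closed B0.

Definition lquot_by of submod_closed B0 : {pred V} := B0.
Local Notation B := (lquot_by B0_submod).

HB.instance Definition _ := GRing.isZmodClosed.Build V B
  (GRing.submod_closedB B0_submod).

Definition lquot : Type := Quotient.quot B.

HB.instance Definition _ := GRing.Zmodule.on lquot.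

Local Notation cls := (\pi_(Quotient.quot B)%qT : V -> lquot).

Definition lquot_scale (c : R) (x : lquot) : lquot :=
  cls (c *: repr (x : Quotient.quot B)).

Lemma lquot_clsE x y : (cls x = cls y) <-> (x - y \in B).
Proof. by rewrite Quotient.idealrBE; split => [/eqP|/eqP]. Qed.

Lemma lquotZ c x : x \in B -> c *: x \in B.
Proof.
have [B00 hB] := B0_submod; move=> hx.
by rewrite -[c *: x]addr0; apply: (hB c x 0).
Qed.

Lemma lquot_scale_cls c x : lquot_scale c (cls x) = cls (c *: x).
Proof.
apply/lquot_clsE; rewrite -scalerBr; apply: lquotZ; apply/lquot_clsE.
exact: reprK.
Qed.

Lemma lquot_clsD x y : cls (x + y) = cls x + cls y.
Proof. exact: Quotient.pi_add. Qed.

Lemma lquot_ind (P : lquot -> Prop) : (forall x, P (cls x)) -> forall y, P y.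
Proof. by move=> h y; have := h (repr (y : Quotient.quot B)); rewrite reprK. Qed.

Fact lquot_scaleA a b v :
  lquot_scale a (lquot_scale b v) = lquot_scale (a * b) v.
Proof. by elim/lquot_ind: v => x; rewrite !lquot_scale_cls scalerA. Qed.

Fact lquot_scale1 : left_id 1 lquot_scale.
Proof. by elim/lquot_ind=> x; rewrite lquot_scale_cls scale1r. Qed.

Fact lquot_scaleDr : right_distributive lquot_scale +%R.
Proof.
move=> a; elim/lquot_ind=> x; elim/lquot_ind=> y.
by rewrite -lquot_clsD !lquot_scale_cls scalerDr lquot_clsD.
Qed.

Fact lquot_scaleDl v : {morph lquot_scale^~ v : a b / a + b}.
Proof.
elim/lquot_ind: v => x a b.
by rewrite !lquot_scale_cls scalerDl lquot_clsD.
Qed.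

HB.instance Definition _ := GRing.Zmodule_isLmodule.Build R lquot
  lquot_scaleA lquot_scale1 lquot_scaleDr lquot_scaleDl.

End LmodQuotient.

(* A polynomial in the entries of a matrix, evaluated at a matrix over a ring *)
(* receiving the coefficients through f.                                      *)
Definition mx_eval (k L : comNzRingType) (f : k -> L) m n (g : 'M[L]_(m, n))
    (q : {mpoly k[m * n]}) : L :=
  mmap f (fun l => mxvec g 0 l) q.

Definition polynomial_map (k : fieldType) (V W V' W' : vectType k)
    (F : 'Hom(V, W) -> 'Hom(V', W')) : Prop :=
  exists Q : 'M[{mpoly k[dim V * dim W]}]_(dim V', dim W'),
    forall f, f2mx (F f) = map_mx (mx_eval idfun (f2mx f)) Q.

Lemma f2mxE (k : fieldType) (V W : vectType k) (f : 'Hom(V, W)) v :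
  v2r (f v) = v2r v *m f2mx f.
Proof. by rewrite unlock /= r2vK. Qed.

Record polyFunctor (k : fieldType) := PolyFunctor {
  pf_obj :> vectType k -> vectType k;
  pf_map : forall V W : vectType k, 'Hom(V, W) -> 'Hom(pf_obj V, pf_obj W);
  pf_id : forall V : vectType k, pf_map (\1 : 'Hom(V, V))%VF = \1%VF;
  pf_comp : forall (U V W : vectType k) (g : 'Hom(V, W)) (f : 'Hom(U, V)),
    pf_map (g \o f)%VF = (pf_map g \o pf_map f)%VF;
  pf_poly : forall V W : vectType k, polynomial_map (@pf_map V W) }.

Definition has_degree (k : fieldType) (P : polyFunctor k) (d : nat) : Prop :=
  forall (V : vectType k) (c : k),
    pf_map P (c *: (\1 : 'Hom(V, V))%VF) = c ^+ d *: \1%VF.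

Section Composition.
Variables (k : fieldType) (P Q : polyFunctor k).

Definition comp_map (V W : vectType k) (f : 'Hom(V, W)) :
    'Hom(P (Q V), P (Q W)) :=
  pf_map P (pf_map Q f).

Lemma comp_id (V : vectType k) : comp_map (\1 : 'Hom(V, V))%VF = \1%VF.
Proof. by rewrite /comp_map !pf_id. Qed.

Lemma comp_comp (U V W : vectType k) (g : 'Hom(V, W)) (f : 'Hom(U, V)) :
  comp_map (g \o f)%VF = (comp_map g \o comp_map f)%VF.
Proof. by rewrite /comp_map !pf_comp. Qed.

Lemma comp_poly (V W : vectType k) : polynomial_map (@comp_map V W).
Proof.
have [A hA] := pf_poly Q V W; have [B hB] := pf_poly P (Q V) (Q W).
exists (map_mx (fun b : {mpoly k[dim (Q V) * dim (Q W)]} =>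
  b \mPo [tuple mxvec A 0 l | l < _]) B) => f.
rewrite /comp_map hB; apply/matrixP => i j; rewrite !mxE.
rewrite /mx_eval -/(meval _ _) -/(meval _ _) comp_mpoly_meval.
apply: meval_eq => l; rewrite tnth_mktuple hA.
by case/mxvec_indexP: l => s t; rewrite !mxvecE !mxE.
Qed.

Definition pfcomp : polyFunctor k := PolyFunctor comp_id comp_comp comp_poly.

End Composition.

(* Sym V is {mpoly k[dim V]}, the basis r2v (delta_mx 0 i) of V going to 'X_i; *)
(* symv is the inclusion of V as the degree 1 part.                           *)
Section Sym.
Variable k : fieldType.
Implicit Types U V W : vectType k.

Definition symv V (v : V) : {mpoly k[dim V]} := \sum_i v2r v 0 i *: 'X_i.

Definition sym_map V W (f : 'Hom(V, W)) (q : {mpoly k[dim V]}) :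
    {mpoly k[dim W]} :=
  q \mPo [tuple symv (f (r2v (delta_mx 0 i))) | i < dim V].

Lemma symvD V : {morph @symv V : u v / u + v}.
Proof.
move=> u v; rewrite /symv -big_split; apply: eq_bigr => i _ /=.
by rewrite linearD mxE scalerDl.
Qed.

Lemma symvZ V c : {morph @symv V : v / c *: v}.
Proof.
move=> v; rewrite /symv scaler_sumr; apply: eq_bigr => i _ /=.
by rewrite linearZ mxE scalerA.
Qed.

Lemma symv0 V : symv (0 : V) = 0.
Proof. by rewrite -(scale0r 0) symvZ scale0r. Qed.

Lemma v2r_sum V (v : V) : v = \sum_i v2r v 0 i *: r2v (delta_mx 0 i).
Proof.
rewrite -{1}[v]v2rK [X in r2v X]row_sum_delta linear_sum.
by apply: eq_bigr => i _; rewrite linearZ.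
Qed.

Lemma sym_map_symv V W (f : 'Hom(V, W)) v : sym_map f (symv v) = symv (f v).
Proof.
rewrite [in RHS](v2r_sum v) linear_sum (big_morph _ (@symvD W) (@symv0 W)).
rewrite /sym_map /symv linear_sum; apply: eq_bigr => i _.
rewrite linearZ /= comp_mpolyXU -tnth_nth tnth_mktuple -/(symv _).
by rewrite -symvZ -linearZ.
Qed.

End Sym.

Section Frobenius.
Variables (k : closedFieldType) (p : nat) (pcharkp : p \in [pchar k]).
Implicit Types U V W : vectType k.

Let p_gt0 : (0 < p)%N.
Proof. exact: prime_gt0 (pcharf_prime pcharkp). Qed.

Let pchar_mpoly n : p \in [pchar {mpoly k[n]}].
Proof. exact: (rmorph_pchar (@mpolyC n k)). Qed.

(* {v^p : v in V}, a subset of Sym^p V; it carries the proof that p is the    *)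
(* characteristic because it is a subspace only then.                         *)
Definition frob_set_of (_ : p \in [pchar k]) V : {pred {mpoly k[dim V]}} :=
  fun q => `[< exists v : V, q = symv v ^+ p >].
Arguments frob_set_of : clear implicits.
Local Notation frob_set := (frob_set_of pcharkp).

Lemma root_exists (c : k) : exists x, c = x ^+ p.
Proof.
have [x hx] := solve_monicpoly (fun i => if i == 0%N then c else 0) p_gt0.
exists x; rewrite hx; case: (p) p_gt0 => // q _.
rewrite big_ord_recl /= expr0 mulr1 big1 ?addr0 // => i _.
by rewrite mul0r.
Qed.

Fact frob_submod V : submod_closed (frob_set V).
Proof.
split=> [|c q r /asboolP[v ->] /asboolP[w ->]]; apply/asboolP.
  by exists 0; rewrite symv0 expr0n gtn_eqF.
have [x ->] := root_exists c; exists (x *: v + w).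
rewrite symvD symvZ -[RHS](pFrobenius_autE (pchar_mpoly _)).
rewrite rmorphD /= !pFrobenius_autE.
by rewrite exprZn.
Qed.

HB.instance Definition _ V :=
  GRing.isSubmodClosed.Build k {mpoly k[dim V]} (frob_set V) (frob_submod V).

Record frob V := Frob {
  frob_val :> {mpoly k[dim V]};
  frob_valP : frob_val \in frob_set V }.

HB.instance Definition _ V := [isSub for @frob_val V].
HB.instance Definition _ V := [Choice of frob V by <:].
HB.instance Definition _ V := [SubChoice_isSubLmodule of frob V by <:].

Definition frob_coord V (q : frob V) : 'rV[k]_(dim V) :=
  \row_i (frob_val q)@_(U_(i) *+ p).

Lemma symvXp V (v : V) : symv v ^+ p = \sum_i v2r v 0 i ^+ p *: 'X_i ^+ p.
Proof.
rewrite -(pFrobenius_autE (pchar_mpoly _)) rmorph_sum; apply: eq_bigr => i _.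
rewrite /= pFrobenius_autE.
by rewrite exprZn.
Qed.

Lemma mcoeff_frob V (r : 'rV[k]_(dim V)) i :
  (\sum_l r 0 l *: 'X_l ^+ p : {mpoly k[dim V]})@_(U_(i) *+ p) = r 0 i.
Proof.
rewrite linear_sum (bigD1 i) //= linearZ /= mpolyXn mcoeffX eqxx mulr1.
rewrite big1 ?addr0 // => l nli; rewrite linearZ /= mpolyXn mcoeffX.
case: eqP => [/mnmP/(_ i)|_]; last by rewrite mulr0.
by rewrite !mulmnE !mnm1E eqxx (negPf nli) mul1n => /eqP; rewrite eq_sym gtn_eqF.
Qed.

Lemma frob_sum_proof V (r : 'rV[k]_(dim V)) :
  \sum_l r 0 l *: 'X_l ^+ p \in frob_set V.
Proof.
apply/asboolP; pose t := \row_l sval (cid (root_exists (r 0 l))).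
exists (r2v t); rewrite symvXp r2vK; apply: eq_bigr => l _.
by rewrite mxE; congr (_ *: _); case: cid.
Qed.

Fact frob_vect_iso V : Vector.axiom (dim V) (frob V).
Proof.
exists (@frob_coord V).
  by move=> c q r; apply/rowP => i; rewrite !mxE /= linearP.
exists (fun r => Frob (frob_sum_proof r)) => [[q hq]|r]; last first.
  by apply/rowP => i; rewrite mxE mcoeff_frob.
apply/val_inj; rewrite /=; have /asboolP[v hv] := hq.
pose r := \row_l (v2r v 0 l ^+ p).
have e : q = \sum_l r 0 l *: 'X_l ^+ p.
  by rewrite hv symvXp; apply: eq_bigr => l _; rewrite mxE.
by rewrite [in RHS]e; apply: eq_bigr => i _; rewrite mxE /= e mcoeff_frob.
Qed.

HB.instance Definition _ V := Lmodule_hasFinDim.Build k (frob V)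
  (frob_vect_iso V).

Lemma sym_map_frob V W (f : 'Hom(V, W)) (q : frob V) :
  sym_map f q \in frob_set W.
Proof.
case: q => q /= /asboolP[v ->]; apply/asboolP; exists (f v).
by rewrite /sym_map rmorphXn /= -/(sym_map f _) sym_map_symv.
Qed.

Definition frob_fun V W (f : 'Hom(V, W)) (q : frob V) : frob W :=
  Frob (sym_map_frob f q).

Fact frob_fun_linear V W (f : 'Hom(V, W)) : linear (frob_fun f).
Proof. by move=> c q r; apply/val_inj; rewrite /= /sym_map linearP. Qed.

HB.instance Definition _ V W (f : 'Hom(V, W)) :=
  GRing.isLinear.Build k (frob V) (frob W) _ (frob_fun f) (frob_fun_linear f).

Definition frob_map V W (f : 'Hom(V, W)) : 'Hom(frob V, frob W) :=
  linfun (frob_fun f).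

Lemma frobP V (q : frob V) : exists v : V, frob_val q = symv v ^+ p.
Proof. by case: q => q /= /asboolP. Qed.

Lemma frob_map_symv V W (f : 'Hom(V, W)) (q : frob V) v :
  frob_val q = symv v ^+ p -> frob_val (frob_map f q) = symv (f v) ^+ p.
Proof.
by move=> h; rewrite lfunE /= h /sym_map rmorphXn /= -/(sym_map f _) sym_map_symv.
Qed.

Lemma frob_id V : frob_map (\1 : 'Hom(V, V))%VF = \1%VF.
Proof.
apply/lfunP => q; apply/val_inj; have [v h] := frobP q.
by rewrite /= (frob_map_symv _ h) !id_lfunE h.
Qed.

Lemma frob_comp U V W (g : 'Hom(V, W)) (f : 'Hom(U, V)) :
  frob_map (g \o f)%VF = (frob_map g \o frob_map f)%VF.
Proof.
apply/lfunP => q; apply/val_inj; have [v h] := frobP q.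
rewrite /= (frob_map_symv _ h) !comp_lfunE.
by rewrite (frob_map_symv _ (frob_map_symv _ h)).
Qed.

Lemma frob_poly V W : polynomial_map (@frob_map V W).
Proof.
pose e i : frob V := r2v (delta_mx 0 i).
have he i : exists v, frob_val (e i) = symv v ^+ p by apply: frobP.
pose v i := sval (cid (he i)).
have hv i : frob_val (e i) = symv (v i) ^+ p by rewrite /v; case: cid.
pose x (l : 'I_(dim W)) : 'rV[k]_(dim (frob W)) :=
  v2r (Frob (@frob_sum_proof W (delta_mx 0 l))).
exists (\matrix_(i, j) \sum_l (x l 0 j)
   *: (\sum_s (v2r (v i) 0 s) *: 'X_(mxvec_index s l)) ^+ p) => f.
apply/matrixP => i j; rewrite [RHS]mxE mxE.
have -> : f2mx (frob_map f) i j = v2r (frob_map f (e i)) 0 j.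
  by rewrite f2mxE r2vK -rowE mxE.
have -> : frob_map f (e i)
    = \sum_l v2r (f (v i)) 0 l ^+ p *: Frob (@frob_sum_proof W (delta_mx 0 l)).
  apply/val_inj; rewrite (linear_sum (val : frob W -> {mpoly k[dim W]})) /=.
  rewrite (frob_map_symv _ (hv i)) symvXp.
  apply: eq_bigr => l _; congr (_ *: _).
  rewrite (bigD1 l) //= mxE !eqxx scale1r big1 ?addr0 // => t ntl.
  by rewrite mxE (negPf ntl) andbF scale0r.
rewrite linear_sum summxE -[RHS]/(meval (fun l => mxvec (f2mx f) 0 l) _).
rewrite linear_sum; apply: eq_bigr => l _.
rewrite linearZ mxE /= mevalZ mulrC; congr (_ * _).
rewrite rmorphXn; congr (_ ^+ _); rewrite raddf_sum f2mxE mxE.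
by apply: eq_bigr => s _; rewrite /= mevalZ mevalXU mxvecE.
Qed.

Definition frobenius : polyFunctor k :=
  PolyFunctor frob_id frob_comp frob_poly.

End Frobenius.

Section MxEval.
Variable k : closedFieldType.

Lemma rmorph_mx_eval (A L : comNzRingType) (phi : {rmorphism A -> L})
    (f : k -> A) m n (g : 'M[A]_(m, n)) q :
  phi (mx_eval f g q) = mx_eval (phi \o f) (map_mx phi g) q.
Proof.
rewrite /mx_eval /mmap rmorph_sum; apply: eq_bigr => t _.
rewrite rmorphM; congr (_ * _); rewrite /mmap1 rmorph_prod.
by apply: eq_bigr => i _; rewrite rmorphXn -map_mxvec mxE.
Qed.

Lemma base_expansion_inj D n (f g : 'I_n -> nat) :
  (forall i, (f i < D)%N) -> (forall i, (g i < D)%N) ->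
  (\sum_i f i * D ^ i = \sum_i g i * D ^ i)%N -> f =1 g.
Proof.
elim: n f g => [f g _ _ _ []//|n IHn f g hf hg].
rewrite !big_ord_recl /= expn0 !muln1.
have tail (h : 'I_n.+1 -> nat) : (\sum_(i < n) h (lift ord0 i) * D ^ bump 0 i
    = (\sum_(i < n) h (lift ord0 i) * D ^ i) * D)%N.
  rewrite big_distrl; apply: eq_bigr => i _ /=.
  by rewrite /bump /= add1n expnSr mulnA.
rewrite !tail => e.
have e0 : f ord0 = g ord0.
  have := congr1 (modn^~ D) e.
  by rewrite ![(_ + _ * D)%N]addnC !modnMDl !modn_small.
move: e; rewrite e0 => /addnI /eqP.
have D0 : (0 < D)%N by apply: leq_ltn_trans (hf ord0).
rewrite eqn_pmul2r // => /eqP /(IHn _ _ (fun i => hf _) (fun i => hg _)) e1 i.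
by case: (unliftP ord0 i) => [j|] ->.
Qed.

Lemma mpoly_ext n (p q : {mpoly k[n]}) : (forall v, p.@[v] = q.@[v]) -> p = q.
Proof.
move=> e; apply/eqP; rewrite -subr_eq0; apply/negPn/negP => nz.
have {e} e v : (p - q).@[v] = 0 by rewrite mevalB e subrr.
move: (p - q) nz e => {p q} p nz e.
pose D := (msize p).+1; pose w (t : 'X_{1..n}) := (\sum_i t i * D ^ i)%N.
have hD t : t \in msupp p -> forall i, (t i < D)%N.
  move=> /msize_mdeg_lt ht i; rewrite ltnS; apply: leq_trans (ltnW ht).
  by rewrite mdegE (bigD1 i) //= leq_addr.
pose s : {poly k} := mmap polyC (fun i => 'X^(D ^ i)) p.
have es x : s.[x] = p.@[fun i => x ^+ (D ^ i)].
  rewrite /s /meval /mmap horner_sum; apply: eq_bigr => t _.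
  rewrite hornerM hornerC /mmap1 horner_prod; congr (_ * _).
  by apply: eq_bigr => i _; rewrite !hornerE.
have cs t : t \in msupp p -> s`_(w t) = p@_t.
  move=> ht; have e1 u : mmap1 (fun i : 'I_n => 'X^(D ^ i)) u = 'X^(w u) :> {poly k}.
    rewrite /mmap1 /w -prodrXr.
    by apply: eq_bigr => i _; rewrite -exprM mulnC.
  rewrite /s /mmap coef_sum (bigD1_seq t) ?msupp_uniq //= e1 coefCM coefXn eqxx.
  rewrite mulr1 big_seq_cond big1 ?addr0 // => u /andP[hu ne].
  rewrite e1 coefCM coefXn; case: eqP => [/esym h|]; last by rewrite mulr0.
  case/eqP: ne; apply/mnmP; apply: base_expansion_inj h; exact: hD.
have : s != 0.
  apply/eqP => s0; case/eqP: nz; apply/mpolyP => t; rewrite mcoeff0.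
  by have [/cs <-|/memN_msupp_eq0 //] := boolP (t \in msupp p); rewrite s0 coef0.
by case/closed_nonrootP => x; rewrite /root es e eqxx.
Qed.

End MxEval.

Section BaseChange.
Variables (k : closedFieldType) (P : polyFunctor k).

Definition poly_law (V W : vectType k) :
    'M[{mpoly k[dim V * dim W]}]_(dim (P V), dim (P W)) :=
  sval (cid (pf_poly P V W)).

(* The map Hom(V, W) (x) L -> Hom(P V, P W) (x) L on matrices, written in the  *)
(* coordinates v2r; the polynomials are unique because k is infinite.          *)
Definition pf_mx (L : comNzRingType) (f : k -> L) (V W : vectType k)
    (g : 'M[L]_(dim V, dim W)) : 'M[L]_(dim (P V), dim (P W)) :=
  map_mx (mx_eval f g) (poly_law V W).

Lemma poly_lawP (V W : vectType k) (f : 'Hom(V, W)) :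
  f2mx (pf_map P f) = pf_mx idfun (f2mx f).
Proof. by rewrite /pf_mx /poly_law; case: cid => Q hQ; apply: hQ. Qed.

Lemma map_pf_mx (A L : comNzRingType) (phi : {rmorphism A -> L}) (f : k -> A)
    (V W : vectType k) (g : 'M[A]_(dim V, dim W)) :
  map_mx phi (pf_mx f g) = pf_mx (phi \o f) (map_mx phi g).
Proof. by apply/matrixP => i j; rewrite !mxE rmorph_mx_eval. Qed.

Lemma f2mx_id (V : vectType k) : f2mx (\1 : 'Hom(V, V))%VF = 1%:M.
Proof.
apply/row_matrixP => i; rewrite !rowE mulmx1 -[X in X *m _]r2vK -f2mxE.
by rewrite id_lfunE r2vK.
Qed.

Lemma f2mx_comp (U V W : vectType k) (g : 'Hom(V, W)) (f : 'Hom(U, V)) :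
  f2mx (g \o f)%VF = f2mx f *m f2mx g.
Proof.
apply/row_matrixP => i; rewrite !rowE -[X in X *m _]r2vK -f2mxE comp_lfunE.
by rewrite !f2mxE r2vK mulmxA.
Qed.

Lemma pf_mx_id (L : comNzRingType) (f : {rmorphism k -> L}) (V : vectType k) :
  @pf_mx L f V V 1%:M = 1%:M.
Proof.
rewrite -{1}(map_mx1 f) -(@map_pf_mx k L f idfun V V).
by rewrite -f2mx_id -poly_lawP pf_id f2mx_id map_mx1.
Qed.

Lemma pf_mx_mul (L : comNzRingType) (f : {rmorphism k -> L})
    (U V W : vectType k) (g : 'M[L]_(dim U, dim V)) (h : 'M[L]_(dim V, dim W)) :
  @pf_mx L f U W (g *m h) = pf_mx f g *m pf_mx f h.
Proof.
pose n := (dim U * dim V + dim V * dim W)%N.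
pose X : 'M[{mpoly k[n]}]_(dim U, dim V) :=
  \matrix_(i, j) 'X_(lshift _ (mxvec_index i j)).
pose Y : 'M[{mpoly k[n]}]_(dim V, dim W) :=
  \matrix_(i, j) 'X_(rshift _ (mxvec_index i j)).
have gen : @pf_mx _ (@mpolyC n k) U W (X *m Y)
    = pf_mx (@mpolyC n k) X *m pf_mx (@mpolyC n k) Y.
  apply/matrixP => i j; apply: mpoly_ext => v.
  suff : map_mx (meval v) (@pf_mx _ (@mpolyC n k) U W (X *m Y))
       = map_mx (meval v) (pf_mx (@mpolyC n k) X *m pf_mx (@mpolyC n k) Y).
    by move/matrixP/(_ i j); rewrite !mxE.
  rewrite map_mxM !map_pf_mx map_mxM.
  have -> : meval v \o @mpolyC n k = idfun by apply/funext => c /=; rewrite mevalC.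
  by rewrite -[map_mx _ X]/(f2mx (Hom _)) -[map_mx _ Y]/(f2mx (Hom (map_mx (meval v) Y)))
     -f2mx_comp -!poly_lawP pf_comp f2mx_comp.
pose vals (l : 'I_n) : L :=
  match split l with inl a => mxvec g 0 a | inr b => mxvec h 0 b end.
pose phi : {rmorphism {mpoly k[n]} -> L} := mmap f vals.
have eX : map_mx phi X = g.
  apply/matrixP => i j; rewrite !mxE /= mmapX mmap1U /vals.
  by rewrite (unsplitK (inl _)) mxvecE.
have eY : map_mx phi Y = h.
  apply/matrixP => i j; rewrite !mxE /= mmapX mmap1U /vals.
  by rewrite (unsplitK (inr _)) mxvecE.
have ef : phi \o @mpolyC n k = f by apply/funext => c /=; rewrite mmapC.
by have := congr1 (map_mx phi) gen; rewrite map_mxM !map_pf_mx map_mxM eX eY ef.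
Qed.

End BaseChange.

(* P^m has homogeneous coordinates x_0, ..., x_m and standard affine charts    *)
(* U_a = {x_a != 0}, a : 'I_m.+1; U_I is the intersection of the U_a, a in I.  *)
Section ProjectiveSpace.
Variables (k : closedFieldType) (m : nat).

Definition ratfun : Type := {fraction {mpoly k[m.+1]}}.

HB.instance Definition _ := GRing.Field.on ratfun.

Definition ratpoly (q : {mpoly k[m.+1]}) : ratfun := tofrac q.
HB.instance Definition _ := GRing.RMorphism.copy ratpoly
  (@tofrac {mpoly k[m.+1]}).

Definition ratconst (c : k) : ratfun := ratpoly c%:MP.
HB.instance Definition _ := GRing.RMorphism.copy ratconst
  (ratpoly \o @mpolyC m.+1 k).

Definition xvar (i : 'I_m.+1) : ratfun := ratpoly 'X_i.

Definition ratfun_scale (c : k) (f : ratfun) : ratfun := ratconst c * f.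

Fact ratfun_scaleA a b f :
  ratfun_scale a (ratfun_scale b f) = ratfun_scale (a * b) f.
Proof. by rewrite /ratfun_scale rmorphM mulrA. Qed.

Fact ratfun_scale1 : left_id 1 ratfun_scale.
Proof. by move=> f; rewrite /ratfun_scale rmorph1 mul1r. Qed.

Fact ratfun_scaleDr : right_distributive ratfun_scale +%R.
Proof. by move=> a f g; rewrite /ratfun_scale mulrDr. Qed.

Fact ratfun_scaleDl f : {morph ratfun_scale^~ f : a b / a + b}.
Proof. by move=> a b; rewrite /ratfun_scale rmorphD mulrDl. Qed.

HB.instance Definition _ := GRing.Zmodule_isLmodule.Build k ratfun
  ratfun_scaleA ratfun_scale1 ratfun_scaleDr ratfun_scaleDl.

(* O(U_I), the degree 0 part of the localization of k[x_0, ..., x_m] at the    *)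
(* product of the x_i, i in I.                                                 *)
Definition regular (I : {set 'I_m.+1}) (f : ratfun) : Prop :=
  exists (N : nat) (q : {mpoly k[m.+1]}),
    q \is (N * #|I|).-homog /\ f = ratpoly q / (\prod_(i in I) xvar i) ^+ N.

Lemma xvar_neq0 i : xvar i != 0.
Proof.
rewrite /xvar /ratpoly tofrac_eq0; apply/eqP => /(congr1 (mcoeff U_(i))).
by rewrite mcoeffX eqxx mcoeff0 => /eqP; rewrite oner_eq0.
Qed.

Let xI (I : {set 'I_m.+1}) := \prod_(i in I) xvar i.

Let xI_neq0 I : xI I != 0.
Proof. by apply/prodf_neq0 => i _; apply: xvar_neq0. Qed.

Let xIE (I : {set 'I_m.+1}) : xI I = ratpoly (\prod_(i in I) 'X_i).
Proof. by rewrite rmorph_prod. Qed.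

Let xI_homog (I : {set 'I_m.+1}) : \prod_(i in I) ('X_i : {mpoly k[m.+1]}) \is #|I|.-homog.
Proof.
rewrite -sum1_card.
elim/big_rec2: _ => [|i d q _ hq]; first exact: dhomog1.
by apply: dhomogM => //; rewrite dhomogX /= mdeg1.
Qed.

Lemma regularC I c : regular I (ratconst c).
Proof.
exists 0%N, c%:MP; split; last by rewrite expr0 divr1.
by rewrite mul0n -[c%:MP]mulr1 mul_mpolyC dhomogZ // dhomog1.
Qed.

Lemma regularM I f g : regular I f -> regular I g -> regular I (f * g).
Proof.
move=> [N [q [hq ->]]] [M [r [hr ->]]]; exists (N + M)%N, (q * r); split.
  by rewrite mulnDl; apply: dhomogM.
by rewrite rmorphM exprD invfM mulrACA.
Qed.

Lemma regularD I f g : regular I f -> regular I g -> regular I (f + g).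
Proof.
move=> [N [q [hq ->]]] [M [r [hr ->]]]; rewrite -/(xI I).
have hx K : (\prod_(i in I) ('X_i : {mpoly k[m.+1]})) ^+ K
    \is (K * #|I|).-homog by rewrite mulnC; apply: dhomogMn.
exists (N + M)%N, (q * (\prod_(i in I) 'X_i) ^+ M + r * (\prod_(i in I) 'X_i) ^+ N).
split.
  rewrite mulnDl; apply: dhomogD; first exact: dhomogM.
  by rewrite addnC; apply: dhomogM.
have := xI_neq0 I; rewrite xIE => h0.
rewrite rmorphD !rmorphM !rmorphXn /= addf_div ?expf_neq0 // -exprD.
by rewrite -xIE.
Qed.

Lemma regularN I f : regular I f -> regular I (- f).
Proof.
move=> hf; rewrite -mulN1r -(rmorphN1 ratconst).
by apply: regularM hf; apply: regularC.
Qed.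

Lemma regular_nat I n : regular I n%:R.
Proof. by rewrite -(rmorph_nat ratconst); apply: regularC. Qed.

Lemma regular_sum I T (r : seq T) (F : T -> ratfun) :
  (forall t, regular I (F t)) -> regular I (\sum_(t <- r) F t).
Proof.
move=> h; elim/big_rec: _ => [|t f _ hf]; last exact: regularD.
exact: (regular_nat I 0).
Qed.

Lemma regular_ratio (I : {set 'I_m.+1}) i a :
  a \in I -> regular I (xvar i / xvar a).
Proof.
move=> aI; exists 1%N, ('X_i * \prod_(b in I :\ a) 'X_b); split.
  rewrite mul1n (cardsD1 a) aI; apply: dhomogM; last exact: xI_homog.
  by rewrite dhomogX /= mdeg1.
have -> : \prod_(i in I) xvar i = xvar a * xI (I :\ a) by exact: big_setD1.
rewrite expr1 rmorphM /= -xIE -/(xvar i) -mulf_div divff ?mulr1 //.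
Qed.

Lemma regular_mx_eval I r s (g : 'M[ratfun]_(r, s)) q :
  (forall i j, regular I (g i j)) -> regular I (mx_eval ratconst g q).
Proof.
move=> h; rewrite /mx_eval /mmap; apply: regular_sum => t.
apply: regularM; first exact: regularC.
rewrite /mmap1; elim/big_rec: _ => [|i f _ hf]; first exact: (regular_nat I 1).
have hi : regular I (mxvec g 0 i) by case/mxvec_indexP: i => u v; rewrite mxvecE.
apply: regularM hf; elim: (t i) => [|e IHe]; first exact: (regular_nat I 1).
by rewrite exprS; apply: regularM.
Qed.

(* A vector bundle, as a cocycle for the covering by the U_a.  The coordinates *)
(* s_a, s_b of a section in the charts a, b, in a basis of the fiber, are row  *)
(* vectors related by s_b = s_a *m trans a b.                                  *)
Record bundle := Bundle {
  fiber : vectType k;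
  trans : 'I_m.+1 -> 'I_m.+1 -> 'M[ratfun]_(dim fiber);
  trans_id : forall a, trans a a = 1%:M;
  trans_comp : forall a b c, trans a b *m trans b c = trans a c;
  trans_reg : forall a b i j, regular [set a; b] (trans a b i j) }.

Section Apply.
Variables (P : polyFunctor k) (E : bundle).

Let tr a b : 'M[ratfun]_(dim (P (fiber E))) := pf_mx P ratconst (trans E a b).

Let tr_id a : tr a a = 1%:M.
Proof. by rewrite /tr trans_id (pf_mx_id P ratconst). Qed.

Let tr_comp a b c : tr a b *m tr b c = tr a c.
Proof. by rewrite /tr -(pf_mx_mul P ratconst) trans_comp. Qed.

Let tr_reg a b i j : regular [set a; b] (tr a b i j).
Proof. by rewrite mxE; apply: regular_mx_eval => s t; apply: trans_reg. Qed.

(* P(E): P applied to the fibers and to the transition isomorphisms.           *)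
Definition pf_bundle : bundle := Bundle tr_id tr_comp tr_reg.

End Apply.

(* Over U_a the cotangent sheaf has basis d(x_i / x_a), i != a, indexed by     *)
(* 'I_m through lift a.  Its transition matrices are the Jacobian matrices of  *)
(* the coordinate changes: in the coordinates y_j = x_j / x_b of U_b we have   *)
(* x_i / x_a = y_i / y_a with y_b = 1, and                                     *)
(*   d(y_i / y_a) / dy_j = [i = j] / y_a - [a = j] y_i / y_a ^ 2.              *)
Definition cotangent_jacobian (a b : 'I_m.+1) : 'M[ratfun]_m :=
  \matrix_(i, j)
    let y l := xvar l / xvar b in
    (lift a i == lift b j)%:R / y a
      - (a == lift b j)%:R * (y (lift a i) / y a ^+ 2).

Let jac_aux (F : fieldType) (x y z : F) : y != 0 -> z != 0 ->
  x / z / (y / z) ^+ 2 = x / y * (z / y).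
Proof. by move=> y0 z0; field; rewrite y0. Qed.

Let jac_entry (F : fieldType) (x : 'I_m.+1 -> F) a b i j : F :=
  (i == j)%:R * (x b / x a) - (a == j)%:R * (x i / x a * (x b / x a)).

Let jacE a b i j :
  cotangent_jacobian a b i j = jac_entry xvar a b (lift a i) (lift b j).
Proof. by rewrite mxE /jac_entry invf_div jac_aux ?xvar_neq0. Qed.

Let jac_entry_id (F : fieldType) (x : 'I_m.+1 -> F) a i j : x a != 0 ->
  jac_entry x a a (lift a i) (lift a j) = (i == j)%:R.
Proof.
move=> xa; rewrite /jac_entry divff // !mulr1 (negPf (neq_lift _ _)) mul0r subr0.
by rewrite (inj_eq lift_inj).
Qed.

Let jac_entry_comp (F : fieldType) (x : 'I_m.+1 -> F) a b c i l :
  (forall t, x t != 0) ->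
  \sum_j jac_entry x a b i (lift b j) * jac_entry x b c (lift b j) l
    = jac_entry x a c i l.
Proof.
move=> x0.
have jb0 : jac_entry x b c b l = 0 by rewrite /jac_entry divff // mul1r subrr.
transitivity (\sum_j jac_entry x a b i j * jac_entry x b c j l).
  by rewrite [RHS](bigD1_ord b) //= jb0 mulr0 add0r.
have pick (g : 'I_m.+1 -> F) t : \sum_j (t == j)%:R * g j = g t.
  rewrite (bigD1 t) //= eqxx mul1r big1 ?addr0 // => j.
  by rewrite eq_sym => /negPf ->; rewrite mul0r.
rewrite (eq_bigr (fun j => (i == j)%:R * (x b / x a * jac_entry x b c j l)
  - (a == j)%:R * (x i / x a * (x b / x a) * jac_entry x b c j l))); last first.
  by move=> j _; rewrite {1}/jac_entry mulrBl -!mulrA.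
rewrite sumrB !pick /jac_entry.
move: (i == l)%:R (a == l)%:R (b == l)%:R => u v w.
by field; rewrite !x0.
Qed.

Lemma cotangent_jacobian_id a : cotangent_jacobian a a = 1%:M.
Proof.
by apply/matrixP => i j; rewrite jacE jac_entry_id ?xvar_neq0 // mxE.
Qed.

Lemma cotangent_jacobian_comp a b c :
  cotangent_jacobian a b *m cotangent_jacobian b c = cotangent_jacobian a c.
Proof.
apply/matrixP => i l; rewrite mxE jacE; under eq_bigr do rewrite !jacE.
by rewrite jac_entry_comp //; apply: xvar_neq0.
Qed.

Lemma cotangent_jacobian_reg a b i j :
  regular [set a; b] (cotangent_jacobian a b i j).
Proof.
have aI : a \in [set a; b] by rewrite !inE eqxx.
have h t := regular_ratio t aI.
rewrite jacE; apply: regularD; first by apply: regularM (h b); apply: regular_nat.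
by apply/regularN/regularM; [apply: regular_nat | apply: regularM].
Qed.

(* lin_mulmxr J is the matrix of v |-> v *m J in the coordinates mxvec = v2r   *)
(* of 'rV_m.                                                                   *)
Let om a b : 'M[ratfun]_(dim 'rV[k]_m) := lin_mulmxr (cotangent_jacobian a b).

Let om_id a : om a a = 1%:M.
Proof.
rewrite /om cotangent_jacobian_id; apply/row_matrixP => i.
by rewrite !rowE mul_rV_lin /= !mulmx1 vec_mxK.
Qed.

Let om_comp a b c : om a b *m om b c = om a c.
Proof.
rewrite /om -(cotangent_jacobian_comp a b c); apply/row_matrixP => i.
by rewrite !rowE mulmxA !mul_rV_lin /= mxvecK mulmxA.
Qed.

Let om_reg a b i j : regular [set a; b] (om a b i j).
Proof.
rewrite /om /lin_mulmxr /lin_mx !mxE /=.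
move: j; rewrite /= => j; case/mxvec_indexP: j => s t; rewrite mxvecE mxE.
apply: regular_sum => u; apply: regularM (cotangent_jacobian_reg _ _ _ _).
by rewrite !mxE; apply: regular_nat.
Qed.

Definition cotangent : bundle := Bundle om_id om_comp om_reg.

(* Cohomology of the locally free sheaf E is Cech cohomology for the covering  *)
(* of P^m by the affine open sets U_a, with alternating cochains: one section  *)
(* over U_I for each I with j + 1 elements.                                    *)
Section Cohomology.
Variable E : bundle.

(* s a is the row of coordinates in the chart a of a rational section; these   *)
(* are kept for all charts, so that restriction to a smaller U_I is inclusion. *)
Definition ratsection : Type := {ffun 'I_m.+1 -> {ffun 'I_(dim (fiber E)) -> ratfun}}.
HB.instance Definition _ := GRing.Lmodule.on ratsection.

(* The sections over U_I, for I nonempty only.                                 *)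
Definition section_on (I : {set 'I_m.+1}) (s : ratsection) : Prop :=
  (forall a b, \row_i s b i = \row_i s a i *m trans E a b) /\
  (forall a i, a \in I -> regular I (s a i)).

Definition ratcochain : Type := {ffun {set 'I_m.+1} -> ratsection}.
HB.instance Definition _ := GRing.Lmodule.on ratcochain.

Definition cochain (j : nat) (s : ratcochain) : Prop :=
  forall I : {set 'I_m.+1}, if #|I| == j.+1 then section_on I (s I) else s I = 0.

(* a is the element of I at position #|[set b in I | b < a]|.                  *)
Definition cech_diff (s : ratcochain) : ratcochain :=
  [ffun I : {set 'I_m.+1} =>
    \sum_(a in I) (-1) ^+ #|[set b in I | (b < a)%N]| *: s (I :\ a)].

Definition is_cocycle j : {pred ratcochain} :=
  fun s => `[< cochain j s /\ cech_diff s = 0 >].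

Definition is_coboundary j : {pred ratcochain} :=
  fun s => `[< if j is i.+1 then exists2 t, cochain i t & s = cech_diff t
               else s = 0 >].

Lemma section_on_submod I c s t :
  section_on I s -> section_on I t -> section_on I (c *: s + t).
Proof.
move=> [s1 s2] [t1 t2]; split=> [a b|a i aI]; last first.
  by rewrite !ffunE; apply: regularD; [apply: regularM; [exact: regularC | exact: s2] | exact: t2].
have e (d : 'I_m.+1) : \row_i (c *: s + t) d i
    = ratconst c *: (\row_i s d i) + \row_i t d i.
  by apply/rowP => i; rewrite !mxE !ffunE.
by rewrite !e (s1 a b) (t1 a b) mulmxDl scalemxAl.
Qed.

Lemma section_on0 I : section_on I 0.
Proof.
split=> [a b|a i _]; last by rewrite !ffunE; apply: (regular_nat I 0).
have e (d : 'I_m.+1) : \row_i (0 : ratsection) d i = 0.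
  by apply/rowP => i; rewrite !mxE !ffunE.
by rewrite !e mul0mx.
Qed.

Lemma cochain_submod j c s t :
  cochain j s -> cochain j t -> cochain j (c *: s + t).
Proof.
move=> hs ht I; have := hs I; have := ht I; rewrite !ffunE.
by case: ifP => _; [move=> h1 h2; apply: section_on_submod | move=> -> ->; rewrite scaler0 addr0].
Qed.

Lemma cochain0 j : cochain j 0.
Proof. by move=> I; rewrite ffunE; case: ifP => // _; apply: section_on0. Qed.

Lemma cech_diff_linear c s t : cech_diff (c *: s + t) = c *: cech_diff s + cech_diff t.
Proof.
apply/ffunP => I; rewrite !ffunE scaler_sumr -big_split; apply: eq_bigr => a _ /=.
by rewrite !ffunE scalerDr !scalerA mulrC.
Qed.

Lemma cech_diff0 : cech_diff 0 = 0.
Proof. by apply/ffunP => I; rewrite !ffunE big1 // => a _; rewrite ffunE scaler0. Qed.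

Lemma is_cocycle_submod j : submod_closed (is_cocycle j).
Proof.
split=> [|c s t /asboolP[s1 s2] /asboolP[t1 t2]]; apply/asboolP.
  by split; [exact: cochain0 | exact: cech_diff0].
by split; [exact: cochain_submod | rewrite cech_diff_linear s2 t2 scaler0 addr0].
Qed.

Lemma is_coboundary_submod j : submod_closed (is_coboundary j).
Proof.
case: j => [|j]; split.
- exact/asboolP.
- by move=> c s t /asboolP -> /asboolP ->; apply/asboolP; rewrite scaler0 addr0.
- by apply/asboolP; exists 0; [exact: cochain0 | rewrite cech_diff0].
move=> c s t /asboolP[u hu ->] /asboolP[v hv ->]; apply/asboolP.
by exists (c *: u + v); [exact: cochain_submod | rewrite cech_diff_linear].
Qed.

HB.instance Definition _ j := GRing.isSubmodClosed.Build k ratcochain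
  (is_cocycle j) (is_cocycle_submod j).

Record cocycle (j : nat) := Cocycle {
  cocycle_val :> ratcochain;
  cocycle_valP : cocycle_val \in is_cocycle j }.

HB.instance Definition _ j := [isSub for @cocycle_val j].
HB.instance Definition _ j := [Choice of cocycle j by <:].
HB.instance Definition _ j := [SubChoice_isSubLmodule of cocycle j by <:].

Definition coboundary j : {pred cocycle j} := fun s => cocycle_val s \in is_coboundary j.

Lemma coboundary_submod j : submod_closed (@coboundary j).
Proof.
have [h0 h] := is_coboundary_submod j.
by split=> [|c s t hs ht]; [exact: h0 | exact: h].
Qed.

Definition cohomology (j : nat) : lmodType k := lquot (coboundary_submod j).

End Cohomology.

End ProjectiveSpace.

(* Main.v *)
Require Import Defs.
From HB Require Import structures.
From mathcomp Require Import all_boot all_order all_algebra.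
From mathcomp Require Import boolp mpoly ring zify.

(* Work in the frame d log (x_i / x_0) of Omega on the torus where all x_i are   *)
(* nonzero.  There the transition matrices are constant, so a rational section *)
(* of Q(Omega) which is regular on the torus is a finite sum of terms x^u * v  *)
(* with v a vector over k, and the Cech complex splits along the weights u.    *)
(* If u <> 0 then u_a < 0 for some a, and only the U_I with a in I carry       *)
(* sections of weight u.  In the chart a, the diagonal matrices split v into   *)
(* parts of weight w in N^m, |w| = deg Q, and such a part is regular on U_I    *)
(* iff w_b <= u_b for all b outside I.  If deg Q <= m then w_b <= u_b for some *)
(* b <> a, so the complex of each part is a cone over b, hence exact.          *)
(* Thus H^j(Q(Omega)) is computed by weight 0, where a section over U_I is a   *)
(* vector v fixed by Q(R), with R a matrix over the prime field depending only *)
(* on I.  Since F^p V and V are isomorphic compatibly with matrices over the   *)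
(* prime field, weight 0 is the same for P and P o F^p; and v |-> v^p is a     *)
(* semilinear bijection from weight 0 for P to weight 0 for F^p o P.  A        *)
(* semilinear bijection preserves dimensions.                                  *)

Set Implicit Arguments.
Unset Strict Implicit.
Unset Printing Implicit Defensive.

Import Order.TTheory GRing.Theory Num.Theory VectorInternalTheory.
Local Open Scope ring_scope.

(** The coordinate torus acts on the Cech complex of Q(Omega), and if the degree of Q is at most the
    dimension of the projective space, only weight 0 contributes to cohomology.

    The weight components of a section regular over U_I are again regular over U_I
    ([wcoef_section_on]), so the complex splits. Regularity of x^u * v amounts to inequalities
    between exponents ([emb_section_on]). For u <> 0 these, together with the degree bound, allow
    each piece to be contracted by a cone ([cdiff_cone], [nonzero_weight_exact]). Hence a basis of
    the finite-dimensional weight 0 cohomology yields a basis of H^j of the same size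
    ([cohomology_basis]).

    In weight 0, the sections over U_I are the vectors fixed by Q applied to an integer matrix
    ([const_sectionP]), so a semilinear bijection commuting with these operators carries bases to
    bases ([quot_basis_transport]). For F o P this bijection is the p-th power map on P(V); for P o
    F it is P applied to the isomorphism V -> F(V) taking e_i to e_i^p, which commutes with matrices
    fixed by Frobenius. The three cohomology spaces thus have bases of one common size. *)

Lemma Posz_sum (T : finType) (F : T -> nat) : Posz (\sum_i F i)%N = \sum_i Posz (F i).
Proof. exact: (big_morph Posz PoszD (erefl _)). Qed.

Lemma sum_mem (T : finType) (A : {set T}) : \sum_i (i \in A)%:Z = #|A|.
Proof.
by rewrite -Posz_sum -sum1_card [in RHS]big_mkcond.
Qed.

(** * Laurent expansions of regular functions *)

Section Laurent.
Variables (k : closedFieldType) (m : nat).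

Definition expo := {ffun 'I_m.+1 -> int}.
Implicit Types (u w e : expo) (I : {set 'I_m.+1}) (f g : ratfun k m) (c : expo -> k).

Definition xmon u : ratfun k m := \prod_i xvar k i ^ u i.

Lemma xmon0 : xmon 0 = 1.
Proof. by rewrite /xmon big1 // => i _; rewrite ffunE expr0z. Qed.

Lemma xmonD u w : xmon (u + w) = xmon u * xmon w.
Proof.
rewrite /xmon -big_split; apply: eq_bigr => i _ /=.
by rewrite ffunE expfzDr ?xvar_neq0.
Qed.

Lemma xmon_neq0 u : xmon u != 0.
Proof. by apply/prodf_neq0 => i _; rewrite expfz_neq0 ?xvar_neq0. Qed.

Lemma xmonN u : xmon (- u) = (xmon u)^-1.
Proof. by apply: (mulIf (xmon_neq0 u)); rewrite -xmonD addNr xmon0 mulVf ?xmon_neq0. Qed.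

Lemma ratpolyX (t : 'X_{1..m.+1}) :
  ratpoly 'X_[t] = xmon [ffun i => Posz (t i)].
Proof.
rewrite mpolyXE_id rmorph_prod; apply: eq_bigr => i _.
by rewrite ffunE -exprnP rmorphXn.
Qed.

Lemma ratpolyZ (a : k) (q : {mpoly k[m.+1]}) :
  ratpoly (a *: q) = ratconst m a * ratpoly q.
Proof. by rewrite -mul_mpolyC rmorphM. Qed.

(* Degree 0, with poles only along the coordinate hyperplanes indexed by I. *)
Definition expo_on I u := (\sum_i u i == 0) && [forall i, (i \notin I) ==> (0 <= u i)].

(** [S] may contain exponents with coefficient 0, so that two expansions can be compared over a
    common list. *)
Definition expands f c (S : seq expo) :=
  [/\ uniq S, forall u, u \notin S -> c u = 0
    & f = \sum_(u <- S) ratconst m (c u) * xmon u].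

Lemma regular_xmon I u : expo_on I u -> regular I (xmon u).
Proof.
(* [N] bounds every |u_i|, so the N-th power of the product of the x_i, i in I, clears the
   denominators of x^u. *)
case/andP=> /eqP u0 /forallP uI; pose N := (\sum_i `|u i|)%N.
pose w i := u i + (i \in I)%:Z * N%:Z.
have w0 i : 0 <= w i.
  rewrite /w; have := uI i; case: (i \in I) => /= [_|]; last by rewrite mul0r addr0.
  have : (`|u i| <= N)%N by rewrite /N (bigD1 i) //= leq_addr.
  by lia.
pose t := [multinom `|w i|%N | i < m.+1].
have tE : [ffun i => Posz (t i)] = [ffun i => w i].
  by apply/ffunP => i; rewrite !ffunE mnmE; have := w0 i; lia.
exists N, 'X_[t]; split.
  rewrite dhomogX /= mdegE.
  suff: Posz (\sum_i t i)%N = (N * #|I|)%N by case=> ->.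
  rewrite PoszM Posz_sum.
  transitivity (\sum_i w i).
    by apply: eq_bigr => i _; have := congr1 (fun f : expo => f i) tE; rewrite !ffunE.
  by rewrite big_split /= u0 add0r -mulr_suml mulrC sum_mem.
rewrite ratpolyX tE.
have -> : (\prod_(i in I) xvar k i) ^+ N = xmon [ffun i => (i \in I)%:Z * N%:Z].
  rewrite -prodrXl big_mkcond /=; apply: eq_bigr => i _; rewrite ffunE.
  by case: (i \in I); rewrite ?mul1r ?mul0r ?expr0z // exprnP.
rewrite -xmonN -xmonD; congr xmon; apply/ffunP => i; rewrite !ffunE /w.
by rewrite addrK.
Qed.

Lemma regular_expands I f : regular I f ->
  exists c S, expands f c S /\ forall u, c u != 0 -> expo_on I u.
Proof.
case=> N [q [hq ->]]; set den := \prod_(i in I) _.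
pose v : expo := [ffun i => (i \in I)%:Z * N%:Z].
have hd : den ^+ N = xmon v.
  rewrite -prodrXl big_mkcond /=; apply: eq_bigr => i _; rewrite ffunE.
  by case: (i \in I); rewrite ?mul1r ?mul0r ?expr0z // exprnP.
pose ex (t : 'X_{1..m.+1}) : expo := [ffun i => Posz (t i)] - v.
have ex_inj : injective ex.
  move=> s t /addIr /ffunP h; apply/mnmP => i.
  by have := h i; rewrite !ffunE => -[].
pose un (u : expo) : 'X_{1..m.+1} := [multinom absz (u i + v i)%R | i < m.+1].
have exK t : un (ex t) = t.
  by apply/mnmP => i; rewrite mnmE !ffunE; lia.
pose S := map ex (msupp q).
pose c u := if u \in S then q@_(un u) else 0.
exists c, S; split; [split|].
- by rewrite map_inj_uniq ?msupp_uniq.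
- by move=> u nu; rewrite /c (negPf nu).
- rewrite hd -xmonN {1}[q]mpolyE rmorph_sum mulr_suml /S [RHS]big_map.
  rewrite [LHS]big_seq [RHS]big_seq; apply: eq_bigr => t ht.
  rewrite /c map_f // exK [X in X * _]ratpolyZ ratpolyX -mulrA -xmonD.
  by congr (_ * xmon _).
move=> u; rewrite /c; case: ifP => [/mapP[t ht ->] _|]; last by rewrite eqxx.
have /dhomogP/(_ t ht)/= := hq; rewrite mdegE => dt.
apply/andP; split.
  have -> : \sum_i ex t i = Posz (\sum_i t i)%N - Posz (#|I| * N)%N.
    rewrite Posz_sum PoszM -sum_mem mulr_suml -sumrB.
    by apply: eq_bigr => i _; rewrite !ffunE.
  by rewrite dt mulnC subrr.
apply/forallP => i; apply/implyP => /negPf ni.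
by rewrite !ffunE ni mul0r subr0.
Qed.

(** Multiplication by a monomial with large exponents turns the relation into one between distinct
    monomials of the polynomial ring. *)
Lemma xmon_free (S : seq expo) c : uniq S ->
  \sum_(u <- S) ratconst m (c u) * xmon u = 0 -> forall u, u \in S -> c u = 0.
Proof.
move=> uS h; pose N := (\sum_(u <- S) \sum_i `|u i|)%N.
have hN u i : u \in S -> (`|u i| <= N)%N.
  by move=> hu; rewrite /N (big_rem u hu) /= (bigD1 i) //= -addnA leq_addr.
pose t (u : expo) := [multinom absz (u i + N%:Z)%R | i < m.+1].
pose v : expo := [ffun i => N%:Z].
have tE u : u \in S -> ratpoly 'X_[t u] = xmon v * xmon u.
  move=> hu; rewrite ratpolyX -xmonD; congr xmon; apply/ffunP => i.
  by rewrite !ffunE mnmE [RHS]addrC gez0_abs //; have := hN u i hu; clear; move: (u i : int) => z; lia.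
have t_inj u w : u \in S -> w \in S -> t u = t w -> u = w.
  move=> hu hw /mnmP e; apply/ffunP => i; have := e i; rewrite !mnmE => e'.
  by have := hN u i hu; have := hN w i hw; move: e'; clear; move: (u i : int) (w i : int) N => x y N; lia.
have : ratpoly (\sum_(u <- S) c u *: 'X_[t u]) = 0 :> ratfun k m.
  transitivity (xmon v * 0); last by rewrite mulr0.
  rewrite rmorph_sum -[in RHS]h mulr_sumr [LHS]big_seq [RHS]big_seq.
  by apply: eq_bigr => u hu; rewrite [LHS]ratpolyZ tE // mulrCA.
move/eqP; rewrite tofrac_eq0 => /eqP e u hu.
have := congr1 (mcoeff (t u)) e; rewrite mcoeff0 linear_sum.
rewrite (bigD1_seq u) //= linearZ /= mcoeffX eqxx mulr1 big_seq_cond big1 ?addr0 //.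
move=> w /andP[hw nwu]; rewrite linearZ /= mcoeffX; case: eqP => [e'|]; last by rewrite mulr0.
by rewrite (t_inj _ _ hw hu e') eqxx in nwu.
Qed.

Definition laurent f := exists c S, expands f c S.

Lemma regular_laurent I f : regular I f -> laurent f.
Proof. by case/regular_expands=> c [S [h _]]; exists c, S. Qed.

Lemma expands_subset f c S S' :
  expands f c S -> uniq S' -> {subset S <= S'} -> expands f c S'.
Proof.
case=> uS c0 -> uS' sub; split=> //.
  by move=> u nu; apply: c0; apply: contra nu; apply: sub.
rewrite [RHS](bigID (mem S)) /= [X in _ + X]big1 ?addr0; last first.
  by move=> u nu; rewrite c0 // rmorph0 mul0r.
rewrite -[RHS]big_filter; apply: perm_big; apply: uniq_perm => //.
  exact: filter_uniq.
by move=> u; rewrite mem_filter /=; case hu: (u \in S) => //=; rewrite sub.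
Qed.

Lemma expandsD f g c d S : expands f c S -> expands g d S ->
  expands (f + g) (fun u => c u + d u) S.
Proof.
case=> uS c0 -> [_ d0 ->]; split=> //.
  by move=> u nu; rewrite c0 // d0 // addr0.
by rewrite -big_split; apply: eq_bigr => u _; rewrite rmorphD mulrDl.
Qed.

Lemma expandsM f c S a e : expands f c S ->
  expands (ratconst m a * xmon e * f) (fun u => a * c (u - e)) [seq u + e | u <- S].
Proof.
case=> uS c0 ->; split.
- by rewrite map_inj_uniq //; apply: addIr.
- move=> u nu; rewrite c0 ?mulr0 //; apply: contra nu => hu.
  by apply/mapP; exists (u - e); rewrite ?subrK.
rewrite big_map mulr_sumr; apply: eq_bigr => u _.
rewrite addrK rmorphM xmonD; set A := ratconst m a; set B := ratconst m (c u).
by rewrite -!mulrA; congr (_ * _); rewrite mulrCA; congr (_ * _); rewrite mulrC.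
Qed.

Lemma expands_uniq f c d S S' : expands f c S -> expands f d S' -> c =1 d.
Proof.
move=> h h' u; pose T := undup (u :: S ++ S').
have uT : uniq T by apply: undup_uniq.
have [_ _ e] : expands f c T.
  by apply: (expands_subset h) => // w hw; rewrite mem_undup inE mem_cat hw orbT.
have [_ _ e'] : expands f d T.
  by apply: (expands_subset h') => // w hw; rewrite mem_undup inE mem_cat hw !orbT.
apply/eqP; rewrite -subr_eq0; apply/eqP.
apply: (@xmon_free T (fun u => c u - d u)) => //; last by rewrite mem_undup inE eqxx.
under eq_bigr do rewrite rmorphB mulrBl.
by rewrite sumrB -e -e' subrr.
Qed.

(* 0 if f is not a Laurent polynomial. *)
Definition lcoef u f : k :=
  if pselect (laurent f) is left h then sval (cid h) u else 0.

Lemma lcoefE f c S u : expands f c S -> lcoef u f = c u.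
Proof.
rewrite /lcoef => h; case: pselect => [h'|[]]; last by exists c, S.
by case: cid => d [S' hd] /=; apply: expands_uniq hd h _.
Qed.

Lemma laurentP f : laurent f -> exists S, expands f (lcoef^~ f) S.
Proof.
case=> c [S h]; exists S; have e u := lcoefE u h.
case: h => uS c0 ef; split=> // [u nu|]; first by rewrite e c0.
by rewrite {1}ef; apply: eq_bigr => u _; rewrite e.
Qed.

Lemma laurentD f g : laurent f -> laurent g -> laurent (f + g) /\
  forall u, lcoef u (f + g) = lcoef u f + lcoef u g.
Proof.
move=> /laurentP[S h] /laurentP[S' h'].
pose T := undup (S ++ S'); have uT : uniq T by apply: undup_uniq.
have h2 : expands f (lcoef^~ f) T.
  by apply: (expands_subset h) => // w hw; rewrite mem_undup mem_cat hw.
have h3 : expands g (lcoef^~ g) T.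
  by apply: (expands_subset h') => // w hw; rewrite mem_undup mem_cat hw orbT.
by have h4 := expandsD h2 h3; split=> [|u]; [do 2!eexists; exact: h4 | exact: lcoefE h4].
Qed.

Lemma laurentM f a e : laurent f -> laurent (ratconst m a * xmon e * f) /\
  forall u, lcoef u (ratconst m a * xmon e * f) = a * lcoef (u - e) f.
Proof.
move=> /laurentP[S /(expandsM a e) h].
by split=> [|u]; [do 2!eexists; exact: h | exact: lcoefE h].
Qed.

Lemma expands0 : expands 0 (fun=> 0) [::].
Proof. by split=> //; rewrite big_nil. Qed.

Lemma laurent_sum (T : Type) (r : seq T) (F : T -> ratfun k m) :
  (forall t, laurent (F t)) -> laurent (\sum_(t <- r) F t) /\
  forall u, lcoef u (\sum_(t <- r) F t) = \sum_(t <- r) lcoef u (F t).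
Proof.
move=> h; elim: r => [|t r [IH1 IH2]].
  rewrite big_nil; split=> [|u]; first by do 2!eexists; exact: expands0.
  by rewrite big_nil (lcoefE u expands0).
have [h1 h2] := laurentD (h t) IH1; rewrite big_cons; split=> // u.
by rewrite big_cons h2 IH2.
Qed.

Lemma laurent1 : laurent 1 /\ forall u, lcoef u 1 = (u == 0)%:R.
Proof.
have h : expands 1 (fun u => (u == 0)%:R) [:: 0].
  split=> //; first by move=> u; rewrite inE => /negPf ->.
  by rewrite big_seq1 eqxx rmorph1 mul1r xmon0.
by split=> [|u]; [do 2!eexists; exact: h | exact: lcoefE h].
Qed.

Lemma regular_lcoef I f u : regular I f -> lcoef u f != 0 -> expo_on I u.
Proof. by case/regular_expands => c [S [/(lcoefE u) -> h]]; apply: h. Qed.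

End Laurent.

(** * Weight decomposition of a polynomial functor *)

Section MpolyMatrices.
Variables (k : closedFieldType) (m : nat).

Lemma mcoeff_scale (t : 'I_m -> k) (q : {mpoly k[m]}) w :
  (mmap (@mpolyC m k) (fun i => t i *: 'X_i) q)@_w = q@_w * mmap1 t w.
Proof.
have e v : mmap1 (fun i => t i *: 'X_i) v = mmap1 t v *: 'X_[v] :> {mpoly k[m]}.
  rewrite /mmap1 mpolyXE_id -scaler_prod; apply: eq_bigr => i _.
  by rewrite exprZn.
rewrite {1}[q]mpolyE rmorph_sum linear_sum /=.
under eq_bigr => v _ do
  rewrite mmapZ mmapX e mul_mpolyC scalerA linearZ /= mcoeffX.
have [hw|hw] := boolP (w \in msupp q).
  rewrite (bigD1_seq w) ?msupp_uniq //= eqxx mulr1 big1 ?addr0 //.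
  by move=> v /negPf ->; rewrite mulr0.
rewrite memN_msupp_eq0 // mul0r big_seq big1 // => v hv.
by case: eqP hw => [<-|_ _]; rewrite ?hv ?mulr0.
Qed.

Lemma map_mcoeff_scale p q (A : 'M[{mpoly k[m]}]_(p, q)) (t : 'I_m -> k) w :
  map_mx (mcoeff w) (map_mx (mmap (@mpolyC m k) (fun i => t i *: 'X_i)) A)
  = mmap1 t w *: map_mx (mcoeff w) A.
Proof. by apply/matrixP => i j; rewrite !mxE mcoeff_scale mulrC. Qed.

Lemma map_mcoeff_mulC p q r (A : 'M[{mpoly k[m]}]_(p, q)) (B : 'M[k]_(q, r)) w :
  map_mx (mcoeff w) (A *m map_mx (@mpolyC m k) B) = map_mx (mcoeff w) A *m B.
Proof.
apply/matrixP => i j; rewrite !mxE linear_sum; apply: eq_bigr => l _.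
by rewrite !mxE /= mulrC mcoeffCM mulrC.
Qed.

Lemma map_meval_inj p q (A B : 'M[{mpoly k[m]}]_(p, q)) :
  (forall v, map_mx (meval v) A = map_mx (meval v) B) -> A = B.
Proof.
move=> e; apply/matrixP => i j; apply: mpoly_ext => v.
by have /matrixP/(_ i j) := e v; rewrite !mxE.
Qed.

Lemma map_mevalC p q (A : 'M[k]_(p, q)) v :
  map_mx (meval v) (map_mx (@mpolyC m k) A) = A.
Proof. by apply/matrixP => i j; rewrite !mxE mevalC. Qed.

Lemma map_mmapC (L : comNzRingType) (f : {rmorphism k -> L}) p q (A : 'M[k]_(p, q)) h :
  map_mx (mmap f h) (map_mx (@mpolyC m k) A) = map_mx f A.
Proof. by apply/matrixP => i j; rewrite !mxE mmapC. Qed.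

End MpolyMatrices.

Section Weights.
Variables (k : closedFieldType) (m : nat) (Q : polyFunctor k).
Local Notation D := (dim (Q 'rV[k]_m)).

(** The coordinates of the row space as a [vectType] are those of [mxvec]; the transition matrices
    of [cotangent] have this form. *)
Definition rmulmx (L : comNzRingType) (A : 'M[L]_m) : 'M[L]_(dim 'rV[k]_m) :=
  lin_mulmxr A.

Lemma rmulmxM (L : comNzRingType) (A B : 'M[L]_m) :
  rmulmx (A *m B) = rmulmx A *m rmulmx B.
Proof.
apply/row_matrixP => i; rewrite !rowE mulmxA /rmulmx.
by rewrite !mul_rV_lin /= mxvecK mulmxA.
Qed.

Lemma rmulmx_scalar (L : comNzRingType) (c : L) : rmulmx c%:M = c%:M.
Proof.
apply/row_matrixP => i; rewrite !rowE mul_rV_lin /= mul_mx_scalar.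
by rewrite linearZ /= vec_mxK mul_mx_scalar.
Qed.

Lemma map_rmulmx (L L' : comNzRingType) (phi : {rmorphism L -> L'}) (A : 'M[L]_m) :
  map_mx phi (rmulmx A) = rmulmx (map_mx phi A).
Proof.
rewrite /rmulmx /lin_mulmxr; apply/matrixP => i j; rewrite /= !mxE /=.
move: j; rewrite /= => j; case/mxvec_indexP: j => s t; rewrite !mxvecE !mxE.
rewrite rmorph_sum; apply: eq_bigr => l _; rewrite rmorphM !mxE.
by rewrite rmorph_nat.
Qed.

Definition pfm (L : comNzRingType) (f : k -> L) (A : 'M[L]_m) : 'M[L]_D :=
  pf_mx Q f (rmulmx A).

Lemma pfmM (L : comNzRingType) (f : {rmorphism k -> L}) (A B : 'M[L]_m) :
  pfm f (A *m B) = pfm f A *m pfm f B.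
Proof. by rewrite /pfm rmulmxM (pf_mx_mul Q f). Qed.

Lemma pfm1 (L : comNzRingType) (f : {rmorphism k -> L}) : pfm f 1%:M = 1%:M.
Proof. by rewrite /pfm rmulmx_scalar (pf_mx_id Q f). Qed.

Lemma map_pfm (L L' : comNzRingType) (phi : {rmorphism L -> L'}) (f : k -> L) A :
  map_mx phi (pfm f A) = pfm (phi \o f) (map_mx phi A).
Proof. by rewrite /pfm map_pf_mx map_rmulmx. Qed.

Lemma pfm_const (L : comNzRingType) (f : {rmorphism k -> L}) (A : 'M[k]_m) :
  map_mx f (pfm idfun A) = pfm f (map_mx f A).
Proof. exact: map_pfm. Qed.

(** The representation of the torus of diagonal matrices on Q(k^m), evaluated at the generic
    diagonal matrix. *)
Definition torus_mx : 'M[{mpoly k[m]}]_D :=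
  pfm (@mpolyC m k) (diag_mx (\row_i 'X_i)).

(** The projection onto the subspace of weight w; [wt_proj_mul] and [wt_proj_sum] show that these
    are orthogonal idempotents with sum 1. *)
Definition wt_proj (w : 'X_{1..m}) : 'M[k]_D := map_mx (mcoeff w) torus_mx.

Lemma pfm_torus (L : comNzRingType) (f : {rmorphism k -> L}) (z : 'rV[L]_m) :
  pfm f (diag_mx z) = map_mx (mmap f (z 0)) torus_mx.
Proof.
have ef : mmap f (z 0) \o @mpolyC m k = f by apply/funext => c /=; rewrite mmapC.
have ez : map_mx (mmap f (z 0)) (diag_mx (\row_i 'X_i)) = diag_mx z.
  by apply/matrixP => i j; rewrite !mxE rmorphMn /= mmapX mmap1U.
by rewrite (map_pfm (mmap f (z 0))) ef ez.
Qed.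

Lemma pfm_torus_mul (t : 'rV[k]_m) :
  torus_mx *m map_mx (@mpolyC m k) (pfm idfun (diag_mx t))
  = map_mx (mmap (@mpolyC m k) (fun i => t 0 i *: 'X_i)) torus_mx.
Proof.
rewrite pfm_const -pfmM.
have -> : diag_mx (\row_i 'X_i) *m map_mx (@mpolyC m k) (diag_mx t)
   = diag_mx (\row_i (t 0 i *: 'X_i)).
  rewrite map_diag_mx mulmx_diag; congr diag_mx; apply/rowP => i.
  by rewrite !mxE mulrC mul_mpolyC.
rewrite (pfm_torus (@mpolyC m k)).
have -> // : (\row_i (t 0 i *: 'X_i : {mpoly k[m]})) 0 = fun i => t 0 i *: 'X_i.
by apply/funext => i; rewrite mxE.
Qed.

(** Multiplying the generic torus element by t replaces X_i by t_i X_i, hence multiplies the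
    coefficient of X^w by t^w, which is [mmap1 (t 0) w]. *)
Lemma wt_proj_torus_k w (t : 'rV[k]_m) :
  wt_proj w *m pfm idfun (diag_mx t) = mmap1 (t 0) w *: wt_proj w.
Proof.
by rewrite -map_mcoeff_mulC pfm_torus_mul map_mcoeff_scale.
Qed.

(** As k is infinite, the identity at all points over k is an identity of polynomial matrices, and
    this specializes to every ring. *)
Lemma wt_proj_torus (L : comNzRingType) (f : {rmorphism k -> L}) w (z : 'rV[L]_m) :
  map_mx f (wt_proj w) *m pfm f (diag_mx z) = mmap1 (z 0) w *: map_mx f (wt_proj w).
Proof.
have gen : map_mx (@mpolyC m k) (wt_proj w) *m torus_mx
     = 'X_[w] *: map_mx (@mpolyC m k) (wt_proj w).
  apply: map_meval_inj => v; rewrite map_mxM map_mxZ /= !map_mevalC.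
  have ev : v = (\row_i v i) 0 by apply/funext => i; rewrite mxE.
  rewrite {1}ev -[map_mx _ torus_mx](pfm_torus idfun) wt_proj_torus_k.
  by rewrite -ev /meval mmapX.
rewrite pfm_torus -(map_mmapC f _ (z 0)) -map_mxM gen map_mxZ /=.
by rewrite mmapX.
Qed.

(** Compare the coefficients of X^v when the generic torus element acts on the part of weight w. *)
Lemma wt_proj_mul w v : wt_proj w *m wt_proj v = (w == v)%:R *: wt_proj w.
Proof.
have := wt_proj_torus (@mpolyC m k) w (\row_i 'X_i).
rewrite -/torus_mx => /(congr1 (map_mx (mcoeff v))).
have -> : map_mx (mcoeff v) (map_mx (@mpolyC m k) (wt_proj w) *m torus_mx)
    = wt_proj w *m wt_proj v.
  rewrite [wt_proj v]/wt_proj; move: (wt_proj w) torus_mx => A B.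
  apply/matrixP => i j; rewrite !mxE linear_sum; apply: eq_bigr => l _.
  by rewrite !mxE /= mcoeffCM.
move=> ->; move: (wt_proj w) => A; apply/matrixP => i j; rewrite !mxE.
have -> : mmap1 ((\row_i0 'X_i0) 0) w = 'X_[w] :> {mpoly k[m]}.
  by rewrite mpolyXE_id; apply: eq_bigr => l _; rewrite mxE.
by rewrite mulrC mcoeffCM mcoeffX mulrC.
Qed.

Variables (e : nat) (degQ : has_degree Q e).

Lemma pfm_scalar (c : k) : pfm idfun c%:M = (c ^+ e)%:M.
Proof.
rewrite /pfm rmulmx_scalar.
have f2mxZ (V : vectType k) a : f2mx (a *: (\1 : 'Hom(V, V))%VF) = a%:M.
  apply/row_matrixP => i; rewrite !rowE -[X in X *m _]r2vK -f2mxE.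
  by rewrite scale_lfunE id_lfunE linearZ /= r2vK mul_mx_scalar.
have := poly_lawP Q (c *: (\1 : 'Hom('rV[k]_m, 'rV[k]_m))%VF).
by rewrite degQ !f2mxZ => ->.
Qed.

(** A scalar c acts on weight w by c^|w| and on all of Q(k^m) by c^e; a c that is not a root of
    X^|w| - X^e separates the two. *)
Lemma wt_proj_deg w : mdeg w != e -> wt_proj w = 0.
Proof.
move=> nwe; have [c hc] : exists c : k, c ^+ mdeg w != c ^+ e.
  have nz : 'X^(mdeg w) - 'X^e != 0 :> {poly k}.
    apply/eqP => /(congr1 (fun r : {poly k} => r`_e)).
    by rewrite coefB !coefXn coef0 eqxx eq_sym (negPf nwe) sub0r => /eqP; rewrite oppr_eq0 oner_eq0.
  have [c] := closed_nonrootP _ nz; rewrite /root !hornerE subr_eq0 => hc.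
  by exists c.
have := wt_proj_torus_k w (const_mx c).
rewrite diag_const_mx pfm_scalar mul_mx_scalar.
have -> : mmap1 ((const_mx c : 'rV_m) 0) w = c ^+ mdeg w.
  rewrite /mmap1 mdegE -prodrXr; apply: eq_bigr => i _; by rewrite mxE.
move/eqP; rewrite -subr_eq0 -scalerBl scaler_eq0 subr_eq0 eq_sym (negPf hc).
by move/eqP.
Qed.

(** The index type consists of the monomials of degree at most e; by [wt_proj_deg] no weight is
    lost. *)
Lemma pfm_diag (L : comNzRingType) (f : {rmorphism k -> L}) (z : 'rV[L]_m) :
  pfm f (diag_mx z) =
  \sum_(w : 'X_{1..m < e.+1}) mmap1 (z 0) w *: map_mx f (wt_proj w).
Proof.
rewrite pfm_torus; apply/matrixP => i j; rewrite mxE summxE.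
have sz : (msize (torus_mx i j) <= e.+1)%N.
  rewrite msizeE; apply/bigmax_leqP_seq => w hw _; rewrite ltnS.
  have [<-//|/wt_proj_deg/matrixP/(_ i j)] := eqVneq (mdeg w) e.
  by rewrite /wt_proj; move: hw; move: torus_mx => T hw; rewrite !mxE => h0;
     rewrite mcoeff_msupp h0 eqxx in hw.
rewrite {1}[torus_mx i j](mpolywE sz) raddf_sum /=; apply: eq_bigr => w _.
rewrite mmapZ mmapX mulrC /wt_proj; by move: torus_mx => T; rewrite !mxE.
Qed.

Lemma wt_proj_sum : \sum_(w : 'X_{1..m < e.+1}) wt_proj w = 1%:M.
Proof.
have := pfm_diag idfun (const_mx 1); rewrite diag_const_mx pfm1 => ->.
apply: eq_bigr => w _; rewrite map_mx_id // /mmap1 big1 ?scale1r // => i _.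
by rewrite mxE expr1n.
Qed.

End Weights.

(** * Logarithmic frames *)

Section LogFrames.
Variables (k : closedFieldType) (m : nat).

(* d log (x_i / x_a) = d log (x_i / x_b) - d log (x_a / x_b), i = lift a _. *)
Definition log_mx (R : pzRingType) (a b : 'I_m.+1) : 'M[R]_m :=
  \matrix_(i, j) ((lift a i == lift b j)%:R - (a == lift b j)%:R).

Lemma log_mx_id R a : log_mx R a a = 1%:M.
Proof.
apply/matrixP => i j; rewrite !mxE (negPf (neq_lift _ _)) subr0.
by rewrite (inj_eq lift_inj).
Qed.

Lemma log_mx_comp R a b c : log_mx R a b *m log_mx R b c = log_mx R a c.
Proof.
apply/matrixP => i l; rewrite !mxE.
pose F j : R := ((lift a i == j)%:R - (a == j)%:R) * ((j == lift c l)%:R - (b == lift c l)%:R).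
(* Summing over all j adds only the term j = b, which is 0. *)
transitivity (\sum_j F j).
  rewrite [RHS](bigD1_ord b) //= {1}/F subrr mulr0 add0r.
  by apply: eq_bigr => j _; rewrite !mxE.
have pick (g : 'I_m.+1 -> R) t : \sum_j (t == j)%:R * g j = g t.
  rewrite (bigD1 t) //= eqxx mul1r big1 ?addr0 // => j.
  by rewrite eq_sym => /negPf ->; rewrite mul0r.
under eq_bigr do rewrite /F mulrBl.
by rewrite sumrB !pick opprB addrA addrNK.
Qed.

Lemma map_log_mx (R R' : pzRingType) (phi : {rmorphism R -> R'}) a b :
  map_mx phi (log_mx R a b) = log_mx R' a b.
Proof. by apply/matrixP => i j; rewrite !mxE rmorphB !rmorph_nat. Qed.

Definition chart_coord (a : 'I_m.+1) : 'rV[ratfun k m]_m :=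
  \row_c (xvar k (lift a c) / xvar k a).
Definition chart_coordV (a : 'I_m.+1) : 'rV[ratfun k m]_m :=
  \row_c (xvar k a / xvar k (lift a c)).

Lemma chart_coordVK a : diag_mx (chart_coordV a) *m diag_mx (chart_coord a) = 1%:M.
Proof.
rewrite mulmx_diag -diag_const_mx; congr diag_mx; apply/rowP => i; rewrite !mxE.
by rewrite mulrA divfK ?xvar_neq0 // divff ?xvar_neq0.
Qed.

Let jac_entry (F : fieldType) (x : 'I_m.+1 -> F) (a b i l : 'I_m.+1) :
  (forall t, x t != 0) -> i != a ->
  (i == l)%:R / (x a / x b) - (a == l)%:R * (x i / x b / (x a / x b) ^+ 2)
  = x i / x a * ((i == l)%:R - (a == l)%:R) * (x b / x l).
Proof.
move=> nz ia; case: (eqVneq i l) => [<-|_]; case: (eqVneq a _) => [e|_].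
- by rewrite e eqxx in ia.
- by rewrite /= mulr1n mulr0n; field; rewrite !nz.
- by rewrite /= mulr1n mulr0n -?e; field; rewrite !nz.
- by rewrite /= mulr0n; field; rewrite !nz.
Qed.

(** Since dy = y d log y, the diagonal factors pass between the frames d(x_i / x_a) and d log (x_i /
    x_a), and the latter have constant transition matrices. *)
Lemma cotangent_jacobianE a b : cotangent_jacobian k a b =
  diag_mx (chart_coord a) *m log_mx _ a b *m diag_mx (chart_coordV b).
Proof.
apply/matrixP => i j; rewrite mul_mx_diag mul_diag_mx.
rewrite /cotangent_jacobian /log_mx /chart_coord /chart_coordV !mxE.
apply: (@jac_entry (ratfun k m) (@xvar k m) a b (lift a i) (lift b j) (@xvar_neq0 k m) _).
by rewrite eq_sym neq_lift.
Qed.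

(* The exponent of the monomial prod_c (x_c / x_a)^(w_c). *)
Definition wexpo (a : 'I_m.+1) (w : 'X_{1..m}) : expo m :=
  [ffun i => if unlift a i is Some c then Posz (w c) else - Posz (mdeg w)].

Lemma wexpo_lift a w c : wexpo a w (lift a c) = w c.
Proof. by rewrite ffunE liftK. Qed.

Lemma wexpo_base a w : wexpo a w a = - Posz (mdeg w).
Proof. by rewrite ffunE unlift_none. Qed.

Lemma wexpo_inj a : injective (wexpo a).
Proof.
move=> v w /ffunP e; apply/mnmP => c.
by have := e (lift a c); rewrite !wexpo_lift => -[].
Qed.

Lemma wexpo_sum a w : \sum_i wexpo a w i = 0.
Proof.
rewrite (bigD1_ord a) //= wexpo_base mdegE Posz_sum addrC.
by apply/eqP; rewrite subr_eq0; apply/eqP/eq_bigr => i _; rewrite wexpo_lift.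
Qed.

Lemma mmap1_chart_coord a w : mmap1 (chart_coord a 0) w = xmon k (wexpo a w).
Proof.
rewrite /xmon (bigD1_ord a) //= wexpo_base /mmap1.
rewrite mdegE -exprnN -prodrXr.
rewrite -prodfV -big_split; apply: eq_bigr => i _ /=.
by rewrite wexpo_lift mxE expr_div_n mulrC -exprnP.
Qed.

Lemma mmap1_chart_coordV a w : mmap1 (chart_coordV a 0) w = xmon k (- wexpo a w).
Proof.
rewrite xmonN -mmap1_chart_coord /mmap1 -prodfV; apply: eq_bigr => i _.
by rewrite -exprVn !mxE invf_div.
Qed.

End LogFrames.

Lemma expo_on_subset m (I I' : {set 'I_m.+1}) (u : expo m) :
  I \subset I' -> expo_on I u -> expo_on I' u.
Proof.
move=> sI /andP[h0 /forallP h]; rewrite /expo_on h0; apply/forallP => i.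
apply/implyP => ni; apply: (implyP (h i)); apply: contra ni.
exact: (subsetP sI).
Qed.

Lemma regular_subset (k : closedFieldType) m (I I' : {set 'I_m.+1}) (f : ratfun k m) :
  I \subset I' -> regular I f -> regular I' f.
Proof.
move=> sI /regular_expands[c [S [[_ _ ->] h]]]; apply: regular_sum => u.
have [->|nz] := eqVneq (c u) 0; first by rewrite rmorph0 mul0r; apply: (regular_nat k I' 0).
apply: regularM; first exact: regularC.
by apply/regular_xmon/(expo_on_subset sI)/h.
Qed.

(** * Vectors of Laurent polynomials and their coefficients *)

Section LaurentVectors.
Variables (k : closedFieldType) (m : nat).
Local Notation rc := (map_mx (ratconst m)).

Definition vlaurent n (r : 'rV[ratfun k m]_n) := forall i, laurent (r 0 i).
Definition vcoef n u (r : 'rV[ratfun k m]_n) : 'rV[k]_n := \row_i lcoef u (r 0 i).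

Lemma vlaurentD n (r s : 'rV_n) : vlaurent r -> vlaurent s -> vlaurent (r + s).
Proof. by move=> hr hs i; rewrite mxE; apply: (laurentD (hr i) (hs i)).1. Qed.

Lemma vcoefD n u (r s : 'rV_n) : vlaurent r -> vlaurent s ->
  vcoef u (r + s) = vcoef u r + vcoef u s.
Proof.
move=> hr hs; apply/rowP => i; rewrite !mxE.
exact: (laurentD (hr i) (hs i)).2.
Qed.

Let scale_entry n p e (r : 'rV_n) (M : 'M[k]_(n, p)) i :
  (xmon k e *: (r *m rc M)) 0 i = \sum_l ratconst m (M l i) * xmon k e * r 0 l.
Proof.
rewrite !mxE mulr_sumr; apply: eq_bigr => l _; rewrite mxE.
by rewrite [r 0 l * _]mulrC mulrA [xmon k e * _]mulrC.
Qed.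

Lemma vlaurentM n p u (r : 'rV_n) (M : 'M[k]_(n, p)) :
  vlaurent r -> vlaurent (xmon k u *: (r *m rc M)).
Proof.
move=> hr i; rewrite scale_entry; apply: (laurent_sum _ _).1 => l.
exact: (laurentM _ _ (hr l)).1.
Qed.

Lemma vcoefM n p u e (r : 'rV_n) (M : 'M[k]_(n, p)) :
  vlaurent r -> vcoef u (xmon k e *: (r *m rc M)) = vcoef (u - e) r *m M.
Proof.
move=> hr; apply/rowP => i; rewrite [LHS]mxE scale_entry.
rewrite (laurent_sum _ _).2 => [|l]; last exact: (laurentM _ _ (hr l)).1.
by rewrite mxE; apply: eq_bigr => l _; rewrite (laurentM _ _ (hr l)).2 mxE mulrC.
Qed.

Lemma vlaurentZ n c (r : 'rV_n) : vlaurent r -> vlaurent (ratconst m c *: r).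
Proof.
move=> hr i; rewrite mxE -[ratconst m c]mulr1 -(xmon0 k m).
exact: (laurentM _ _ (hr i)).1.
Qed.

Lemma vcoefZ n u c (r : 'rV_n) : vlaurent r ->
  vcoef u (ratconst m c *: r) = c *: vcoef u r.
Proof.
move=> hr; apply/rowP => i; rewrite !mxE -[ratconst m c]mulr1 -(xmon0 k m).
by rewrite (laurentM _ _ (hr i)).2 subr0.
Qed.

Lemma vlaurent_sum n (T : Type) (r : seq T) (F : T -> 'rV_n) :
  (forall t, vlaurent (F t)) -> vlaurent (\sum_(t <- r) F t).
Proof.
move=> h i; rewrite summxE; apply: (laurent_sum _ _).1 => t; exact: h.
Qed.

Lemma vcoef_sum n u (T : Type) (r : seq T) (F : T -> 'rV_n) :
  (forall t, vlaurent (F t)) -> vcoef u (\sum_(t <- r) F t) = \sum_(t <- r) vcoef u (F t).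
Proof.
move=> h; apply/rowP => i; rewrite mxE !summxE (laurent_sum _ _).2 => [|t]; last exact: h.
by apply: eq_bigr => t _; rewrite mxE.
Qed.

Lemma vlaurent_const n (v : 'rV[k]_n) : vlaurent (rc v).
Proof.
move=> i; rewrite mxE -[ratconst _ _]mulr1 -[ratconst _ _]mulr1 -{1}(xmon0 k m).
by apply: (laurentM _ _ (laurent1 k m).1).1.
Qed.

Lemma vcoef_const n u (v : 'rV[k]_n) : vcoef u (rc v) = (u == 0)%:R *: v.
Proof.
apply/rowP => i; rewrite !mxE -[ratconst _ _]mulr1 -[ratconst _ _]mulr1 -{1}(xmon0 k m).
by rewrite (laurentM _ _ (laurent1 k m).1).2 (laurent1 k m).2 subr0 mulrC.
Qed.

(** One list of exponents serves the whole finite family; it contains 0 so that weight 0 can be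
    split off. *)
Lemma vlaurent_expand (T : finType) n (F : T -> 'rV[ratfun k m]_n) :
  (forall t, vlaurent (F t)) -> exists S : seq (expo m), [/\ uniq S, 0 \in S &
    forall t, F t = \sum_(u <- S) xmon k u *: rc (vcoef u (F t))].
Proof.
move=> h; pose X := (T * 'I_n)%type.
pose S (x : X) := sval (cid (laurentP (h x.1 x.2))).
have hS (x : X) : expands (F x.1 0 x.2) (fun u => lcoef u (F x.1 0 x.2)) (S x).
  by rewrite /S; case: cid.
exists (undup (0 :: flatten [seq S x | x <- enum {: X}])).
split; rewrite ?undup_uniq ?mem_undup ?inE ?eqxx // => t.
apply/rowP => i; rewrite summxE.
have [||_ _ {1}->] := expands_subset (S' := undup (0 :: flatten [seq S x | x <- enum {: X}])) (hS (t, i)).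
- exact: undup_uniq.
- move=> u hu; rewrite mem_undup inE; apply/orP; right; apply/flattenP.
  by exists (S (t, i)) => //; apply: map_f; rewrite mem_enum.
by apply: eq_bigr => u _; rewrite !mxE mulrC.
Qed.

End LaurentVectors.

(** * Rearranging products of scalars and matrices *)

Section Scaling.
Variable F : comNzRingType.

Let scale_mul_lin n p (x c : F) (A B : 'rV_n) (M : 'M_(n, p)) :
  x *: ((c *: A + B) *m M) = c *: (x *: (A *m M)) + x *: (B *m M).
Proof. by rewrite mulmxDl scalerDr -scalemxAl !scalerA mulrC. Qed.

Lemma scale_mul_linear (k : comNzRingType) (phi : {rmorphism k -> F}) n p q (x : F) (c : k)
    (A B : 'rV_n) (M : 'M_(n, p)) (N : 'M_(p, q)) :
  x *: (map_mx phi ((c *: A + B) *m M) *m N)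
  = phi c *: (x *: (map_mx phi (A *m M) *m N)) + x *: (map_mx phi (B *m M) *m N).
Proof. by rewrite -scale_mul_lin mulmxDl -scalemxAl map_mxD map_mxZ. Qed.

Lemma scale_mulK n p q r (x : F) (A : 'rV_n) (B : 'M_(n, p)) (B' : 'M_(p, n))
    (M : 'M_(n, q)) (N : 'M_(q, r)) :
  B *m B' = 1%:M -> (x *: (A *m B)) *m (B' *m M *m N) = x *: (A *m M *m N).
Proof. by move=> h; rewrite -scalemxAl -!mulmxA (mulmxA B) h mul1mx. Qed.

Lemma scale_map_mul (k : comNzRingType) (phi : {rmorphism k -> F}) n p q (x y : F)
    (A : 'M_(n, p)) (B : 'M_(p, q)) :
  x *: (map_mx phi A *m (y *: map_mx phi B)) = (x * y) *: map_mx phi (A *m B).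
Proof. by rewrite -scalemxAr scalerA map_mxM. Qed.

Lemma mulmxK3 n p q r t (A : 'M[F]_(n, p)) (B : 'M_(p, q)) (C : 'M_(q, r)) (M : 'M_(r, t)) N :
  M *m N = 1%:M -> A *m (B *m C *m M) *m N = A *m B *m C.
Proof. by move=> h; rewrite -!mulmxA h mulmx1 mulmxA. Qed.

Lemma scale_mulVK n p (x : F) (A : 'M_(n, p)) (M N : 'M_p) :
  M *m N = 1%:M -> (x *: (A *m M)) *m N = x *: A.
Proof. by move=> h; rewrite -scalemxAl -mulmxA h mulmx1. Qed.

Lemma mulmx_scale_map (k : comNzRingType) (phi : {rmorphism k -> F}) n p q r (x : F)
    (A : 'M_(n, p)) (B : 'M_(p, q)) (C : 'M_(q, r)) :
  A *m (x *: map_mx phi B) *m map_mx phi C = x *: (A *m map_mx phi (B *m C)).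
Proof. by rewrite -scalemxAr -scalemxAl -mulmxA map_mxM. Qed.

Lemma scale_map_mulmx (k : comNzRingType) (phi : {rmorphism k -> F}) n p q r (x : F)
    (A : 'M_(n, p)) (B : 'M_(p, q)) (C : 'M_(q, r)) :
  (x *: map_mx phi A) *m map_mx phi B *m C = x *: (map_mx phi (A *m B) *m C).
Proof. by rewrite -!scalemxAl map_mxM. Qed.

End Scaling.

(** * Sections of Q(Omega) and their weight components *)

Section Sections.
Variables (k : closedFieldType) (m : nat) (Q : polyFunctor k).
Variables (e : nat) (degQ : has_degree Q e).
Local Notation D := (dim (Q 'rV[k]_m)).
Local Notation E := (pf_bundle Q (cotangent k m)).
Local Notation rc := (map_mx (ratconst m)).
Local Notation sect := (ratsection E).
Local Opaque pfm wt_proj.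
Implicit Types (u : expo m) (v : 'rV[k]_D) (I : {set 'I_m.+1}) (s t : sect).

(** With Q applied throughout: [to_log a] converts row coordinates of the chart a into its
    logarithmic frame, [of_log a] converts back, and [log_ch] changes between logarithmic frames. *)
Definition to_log a : 'M[ratfun k m]_D := pfm Q (ratconst m) (diag_mx (chart_coord k a)).
Definition of_log a : 'M[ratfun k m]_D := pfm Q (ratconst m) (diag_mx (chart_coordV k a)).
Definition log_ch a b : 'M[k]_D := pfm Q idfun (log_mx k a b).

Lemma log_chK a b : log_ch a b *m log_ch b a = 1%:M.
Proof. by rewrite /log_ch -(pfmM Q idfun) log_mx_comp log_mx_id (pfm1 _ Q idfun). Qed.

Lemma log_ch_comp a b c : log_ch a b *m log_ch b c = log_ch a c.
Proof. by rewrite /log_ch -(pfmM Q idfun) log_mx_comp. Qed.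

Lemma log_ch_id a : log_ch a a = 1%:M.
Proof. by rewrite /log_ch log_mx_id (pfm1 _ Q idfun). Qed.

Lemma of_logK a : of_log a *m to_log a = 1%:M.
Proof. by rewrite /to_log -(pfmM Q (ratconst m)) chart_coordVK (pfm1 _ Q (ratconst m)). Qed.

Lemma transE a b : trans E a b = to_log a *m rc (log_ch a b) *m of_log b.
Proof.
rewrite /log_ch (pfm_const Q (ratconst m)) map_log_mx -!(pfmM Q (ratconst m)).
by rewrite -cotangent_jacobianE.
Qed.

Lemma to_log_sum a : to_log a =
  \sum_(w : 'X_{1..m < e.+1}) xmon k (wexpo a w) *: rc (wt_proj Q w).
Proof.
rewrite /to_log (pfm_diag degQ (ratconst m)).
by apply: eq_bigr => w _; rewrite mmap1_chart_coord.
Qed.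

Lemma of_log_sum a : of_log a =
  \sum_(w : 'X_{1..m < e.+1}) xmon k (- wexpo a w) *: rc (wt_proj Q w).
Proof.
rewrite /of_log (pfm_diag degQ (ratconst m)).
by apply: eq_bigr => w _; rewrite mmap1_chart_coordV.
Qed.

Local Opaque to_log of_log.

Definition srow s a : 'rV[ratfun k m]_D := \row_i s a i.

Definition glues s := forall a b, srow s b = srow s a *m trans E a b.

(** One chart suffices: the transition from a to b is regular on the intersection of U_a and U_b,
    which contains U_I when b is in I. *)
Lemma section_onP I a s : a \in I ->
  section_on I s <-> glues s /\ forall i, regular I (s a i).
Proof.
move=> aI; split=> [[h1 h2]|[h1 h2]]; first by split=> // i; apply: h2.
split=> // b i bI.
have -> : s b i = \sum_l srow s a 0 l * trans E a b l i.
  by have /rowP/(_ i) := h1 a b; rewrite 2!mxE.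
apply: regular_sum => l.
apply: regularM; first by rewrite mxE.
apply: (@regular_subset k m [set a; b]); last exact: trans_reg.
by apply/subsetP => x; rewrite !inE => /orP[] /eqP->.
Qed.

(* The section x^u * v, v being given in the frame d log (x_i / x_0). *)
Definition emb u v : sect :=
  [ffun a => [ffun i => (xmon k u *: (rc (v *m log_ch 0 a) *m of_log a)) 0 i]].

Lemma srow_emb u v a : srow (emb u v) a = xmon k u *: (rc (v *m log_ch 0 a) *m of_log a).
Proof. by apply/rowP => i; rewrite mxE 2!ffunE. Qed.

Local Opaque emb.

Lemma srow_inj s t : (forall a, srow s a = srow t a) -> s = t.
Proof.
move=> h; apply/ffunP => a; apply/ffunP => i.
by have /rowP/(_ i) := h a; rewrite !mxE.
Qed.

Lemma srow_lin c s t a : srow (c *: s + t) a = ratconst m c *: srow s a + srow t a.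
Proof. by apply/rowP => i; rewrite !mxE !ffunE. Qed.

Lemma srow0 a : srow 0 a = 0.
Proof. by apply/rowP => i; rewrite !mxE !ffunE. Qed.

Lemma emb_lin u c v w : emb u (c *: v + w) = c *: emb u v + emb u w.
Proof.
apply: srow_inj => a.
apply: etrans (srow_emb _ _ _) _; rewrite (srow_lin c (emb u v) (emb u w) a).
apply: etrans (scale_mul_linear (ratconst m) _ _ _ _ _ _) _.
by congr (_ *: _ + _); apply/esym/srow_emb.
Qed.

HB.instance Definition _ u :=
  GRing.isLinear.Build k 'rV[k]_D sect _ (emb u) (emb_lin u).

Lemma emb_glues u v : glues (emb u v).
Proof.
move=> a b; rewrite !srow_emb transE (scale_mulK _ _ _ _ (of_logK a)).
by rewrite -(map_mxM (ratconst m)) -mulmxA log_ch_comp.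
Qed.

(** In the chart a, the part of weight w of v is multiplied by the inverse of the monomial
    [wexpo a w]; distinct w give distinct monomials, so nothing cancels. *)
Lemma srow_emb_sum u v a : srow (emb u v) a =
  \sum_(w : 'X_{1..m < e.+1}) xmon k (u - wexpo a w) *: rc (v *m log_ch 0 a *m wt_proj Q w).
Proof.
rewrite srow_emb of_log_sum mulmx_sumr scaler_sumr; apply: eq_bigr => w _.
by rewrite xmonD; apply: (scale_map_mul (ratconst m)).
Qed.

Lemma vlaurent_scale_const u v : vlaurent (xmon k u *: rc v).
Proof. by rewrite -[rc v]mulmx1 -(map_mx1 (ratconst m)); apply/vlaurentM/vlaurent_const. Qed.

Lemma vcoef_scale_const u u' v : vcoef u (xmon k u' *: rc v) = (u == u')%:R *: v.
Proof.
rewrite -[rc v]mulmx1 -(map_mx1 (ratconst m)) vcoefM; last exact: vlaurent_const.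
by rewrite vcoef_const mulmx1 subr_eq0.
Qed.

Lemma vcoef_emb_chart u v a (w : 'X_{1..m < e.+1}) :
  vcoef (u - wexpo a w) (srow (emb u v) a) = v *m log_ch 0 a *m wt_proj Q w.
Proof.
rewrite srow_emb_sum vcoef_sum => [|w']; last exact: vlaurent_scale_const.
rewrite (bigD1 w) //= [X in X + _]vcoef_scale_const eqxx scale1r big1 ?addr0 // => w' nw.
rewrite vcoef_scale_const (inj_eq (addrI _)) (inj_eq oppr_inj) (inj_eq (@wexpo_inj _ a)).
by rewrite eq_sym (inj_eq val_inj) (negPf nw) scale0r.
Qed.

(** Regularity can be tested on each monomial of [srow_emb_sum] separately. *)
Lemma emb_section_on I a u v : a \in I ->
  section_on I (emb u v) <-> forall w : 'X_{1..m < e.+1},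
    v *m log_ch 0 a *m wt_proj Q w != 0 -> expo_on I (u - wexpo a w).
Proof.
move=> aI; split=> [/(section_onP _ aI)[_ h] w nz|h].
  have hv i : emb u v a i = srow (emb u v) a 0 i by rewrite mxE.
  have /rV0Pn[i hi] := nz; move: (h i); rewrite hv srow_emb_sum summxE => hr.
  apply: (regular_lcoef hr).
  have := congr1 (fun r : 'rV_D => r 0 i) (vcoef_emb_chart u v a w).
  by rewrite mxE srow_emb_sum summxE => ->.
apply/(section_onP _ aI); split=> [|i]; first exact: emb_glues.
have -> : emb u v a i = srow (emb u v) a 0 i by rewrite mxE.
rewrite srow_emb_sum summxE; apply: regular_sum => w; rewrite mxE.
have [->|nz] := eqVneq (v *m log_ch 0 a *m wt_proj Q w) 0.
  by rewrite !mxE rmorph0 mulr0; apply: (regular_nat k I 0).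
by apply: regularM; [apply/regular_xmon/h | rewrite mxE; apply: regularC].
Qed.

(** Coordinates in the frame d log (x_i / x_0); [glues_slog] computes them from any chart. *)
Definition slog s : 'rV[ratfun k m]_D := srow s 0 *m to_log 0.

Lemma glues_slog s a : glues s -> slog s = srow s a *m to_log a *m rc (log_ch a 0).
Proof.
by move=> /(_ a 0); rewrite /slog transE => ->; apply/mulmxK3/of_logK.
Qed.

Lemma glues_srow s a : glues s -> srow s a = slog s *m rc (log_ch 0 a) *m of_log a.
Proof. by move=> /(_ 0 a); rewrite /slog transE => ->; rewrite !mulmxA. Qed.

Lemma slog_lin c s t : slog (c *: s + t) = ratconst m c *: slog s + slog t.
Proof. by rewrite /slog (srow_lin c s t 0) mulmxDl -scalemxAl. Qed.

Definition torus_section s := glues s /\ vlaurent (slog s).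

Let slog_sum s a : glues s -> slog s =
  \sum_(w : 'X_{1..m < e.+1})
     xmon k (wexpo a w) *: (srow s a *m rc (wt_proj Q w *m log_ch a 0)).
Proof.
move=> h; rewrite (glues_slog a h) to_log_sum mulmx_sumr mulmx_suml.
by apply: eq_bigr => w _; apply: (mulmx_scale_map (ratconst m)).
Qed.

Lemma section_torus I a s : a \in I -> section_on I s -> torus_section s.
Proof.
move=> aI /(section_onP _ aI)[h1 h2]; split=> //.
rewrite (slog_sum a h1); apply: vlaurent_sum => w; apply: vlaurentM => i.
by rewrite mxE; apply: regular_laurent (h2 i).
Qed.

Lemma torus_section0 : torus_section 0.
Proof.
split=> [a b|i]; first by rewrite !srow0 mul0mx.
by rewrite /slog srow0 mul0mx mxE; apply: regular_laurent (regular_nat k setT 0).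
Qed.

Lemma torus_section_lin c s t :
  torus_section s -> torus_section t -> torus_section (c *: s + t).
Proof.
move=> [s1 s2] [t1 t2]; split=> [a b|].
  by rewrite !(srow_lin c s t) (s1 a b) (t1 a b) mulmxDl -scalemxAl.
by rewrite slog_lin; apply: vlaurentD => //; apply: vlaurentZ.
Qed.

(* The component of weight u of s is emb u (wcoef u s). *)
Definition wcoef u s : 'rV[k]_D := vcoef u (slog s).

Lemma wcoef_lin u c s t : torus_section s -> torus_section t ->
  wcoef u (c *: s + t) = c *: wcoef u s + wcoef u t.
Proof.
move=> [s1 s2] [t1 t2]; rewrite /wcoef slog_lin vcoefD ?vcoefZ //.
exact: vlaurentZ.
Qed.

Lemma wcoef0 u : wcoef u 0 = 0.
Proof.
have := wcoef_lin u 1 torus_section0 torus_section0; rewrite !scale1r addr0.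
by move/eqP; rewrite -subr_eq0 opprD addNKr oppr_eq0 => /eqP.
Qed.

Lemma wcoef_sum u (T : Type) (r : seq T) (P : pred T) (c : T -> k) (F : T -> sect) :
  (forall x, torus_section (F x)) ->
  wcoef u (\sum_(x <- r | P x) c x *: F x) = \sum_(x <- r | P x) c x *: wcoef u (F x).
Proof.
move=> h.
suff [] : torus_section (\sum_(x <- r | P x) c x *: F x) /\
  wcoef u (\sum_(x <- r | P x) c x *: F x) = \sum_(x <- r | P x) c x *: wcoef u (F x) by [].
elim: r => [|x r [IH1 IH2]].
  by rewrite !big_nil wcoef0; split=> //; apply: torus_section0.
rewrite !big_cons; case: (P x) => //.
by split; [apply: torus_section_lin | rewrite wcoef_lin // IH2].
Qed.

Lemma slog_emb u v : slog (emb u v) = xmon k u *: rc v.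
Proof.
by rewrite /slog srow_emb log_ch_id mulmx1; apply/scale_mulVK/of_logK.
Qed.

Lemma wcoef_emb u u' v : wcoef u (emb u' v) = (u == u')%:R *: v.
Proof. by rewrite /wcoef slog_emb vcoef_scale_const. Qed.

(** In the chart a, the part of weight w of the component of weight u is a projection of a single
    Laurent coefficient of the coordinates of s, and these coordinates are regular on U_I. *)
Lemma wcoef_section_on I a u s : a \in I -> section_on I s ->
  section_on I (emb u (wcoef u s)).
Proof.
move=> aI hs; have [h1 h2] := (section_onP _ aI).1 hs.
apply/(emb_section_on _ _ aI) => w.
have hl : vlaurent (srow s a) by move=> i; rewrite mxE; apply: regular_laurent (h2 i).
have -> : wcoef u s *m log_ch 0 a *m wt_proj Q w
    = vcoef (u - wexpo a w) (srow s a) *m wt_proj Q w.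
  rewrite /wcoef (slog_sum a h1) vcoef_sum => [|w']; last exact: vlaurentM.
  rewrite !mulmx_suml (bigD1 w) //= [X in _ + X]big1 ?addr0 => [|w' nw].
    by rewrite vcoefM // -!mulmxA (mulmxA (log_ch a 0)) log_chK mul1mx wt_proj_mul eqxx scale1r.
  rewrite vcoefM // -!mulmxA (mulmxA (log_ch a 0)) log_chK mul1mx wt_proj_mul.
  by rewrite (inj_eq val_inj) (negPf nw) scale0r mulmx0.
move=> nz; have /rV0Pn[i] : vcoef (u - wexpo a w) (srow s a) != 0.
  by apply: contraNneq nz => ->; rewrite mul0mx.
by rewrite !mxE; apply: regular_lcoef.
Qed.

Lemma srow_sum (T : Type) (r : seq T) (F : T -> sect) a :
  srow (\sum_(x <- r) F x) a = \sum_(x <- r) srow (F x) a.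
Proof.
elim: r => [|x r IH]; first by rewrite !big_nil srow0.
rewrite !big_cons -IH -[F x in LHS]scale1r (srow_lin 1 (F x)) rmorph1.
by rewrite scale1r.
Qed.

Lemma torus_section_expand (T : finType) (F : T -> sect) :
  (forall x, torus_section (F x)) -> exists S : seq (expo m), [/\ uniq S, 0 \in S &
    forall x, F x = \sum_(u <- S) emb u (wcoef u (F x))].
Proof.
move=> h; have [S [uS S0 hS]] := vlaurent_expand (fun x => (h x).2).
exists S; split=> // x; apply: srow_inj => a; rewrite srow_sum.
rewrite (glues_srow a (h x).1) hS !mulmx_suml; apply: eq_bigr => u _.
apply: etrans (scale_map_mulmx (ratconst m) _ _ _ _) _.
exact/esym/srow_emb.
Qed.

End Sections.

(** * Exactness in nonzero weight *)

Section CechCone.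
Variables (R : comNzRingType) (X : lmodType R) (n : nat).
Implicit Types (v : {set 'I_n} -> X) (I J : {set 'I_n}) (a b : 'I_n).

Definition below I a := #|[set b in I | (b < a)%N]|.

Definition cdiff v I : X := \sum_(a in I) (-1) ^+ below I a *: v (I :\ a).

(** The contracting homotopy, with apex b, of the cochain complex of a simplex. *)
Definition cone b v J : X :=
  if b \in J then 0 else (-1) ^+ below J b *: v (b |: J).

Lemma below_setU1 I a b : b \notin I -> below (b |: I) a = ((b < a) + below I a)%N.
Proof.
move=> bI; rewrite /below; case: (boolP (b < a)%N) => ba.
  have -> : [set c in b |: I | (c < a)%N] = b |: [set c in I | (c < a)%N].
    by apply/setP => c; rewrite !inE; case: eqP => [->|] //=; rewrite ba.
  by rewrite cardsU1 inE (negPf bI).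
rewrite add0n; apply: eq_card => c; rewrite !inE.
by case: eqP => [->|] //=; rewrite (negPf ba) andbF.
Qed.

(* The identity d h + h d = 1 for the homotopy h = cone b, where d v = 0. *)
Lemma cdiff_cone b v I : cdiff v (b |: I) = 0 -> cdiff (cone b v) I = v I.
Proof.
move=> h; have sq N : (-1) ^+ N * (-1) ^+ N = 1 :> R.
  by rewrite -exprMn mulrNN mulr1 expr1n.
have [bI|bI] := boolP (b \in I).
  rewrite /cdiff (bigD1 b) //= big1 ?addr0 => [|a /andP[aI nab]].
    rewrite /cone setD11 setD1K // scalerA.
    have -> : below I b = below (I :\ b) b.
      by rewrite -{1}(setD1K bI) below_setU1 ?setD11 // ltnn.
    by rewrite sq scale1r.
  by rewrite /cone in_setD1 eq_sym nab bI /= scaler0.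
move: h; rewrite /cdiff big_setU1 //= setU1K // below_setU1 // ltnn add0n.
move=> /(congr1 (fun x => (-1) ^+ below I b *: x)).
rewrite scalerDr scalerA sq scale1r scaler0 => /eqP; rewrite addr_eq0 => /eqP ->.
rewrite scaler_sumr -sumrN; apply: eq_bigr => a aI.
have nab : a != b by apply: contraNneq bI => <-.
have -> : (b |: I) :\ a = b |: I :\ a.
  by apply/setP => c; rewrite !inE; case: (eqVneq c a) => // ->; rewrite (negPf nab).
rewrite /cone in_setD1 (negPf bI) andbF !scalerA -scaleNr; congr (_ *: _).
have -> : below I b = ((a < b) + below (I :\ a) b)%N.
  by rewrite -{1}(setD1K aI) below_setU1 ?setD11.
rewrite below_setU1 // !exprD; set x := (-1) ^+ below I a; set y := (-1) ^+ below _ b.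
have : (-1) ^+ (a < b)%N * (-1) ^+ (b < a)%N = -1 :> R.
  by case: ltngtP => [_|_|/val_inj/eqP]; rewrite ?expr1 ?expr0 ?mul1r ?mulr1 ?(negPf nab).
move: (_ ^+ (a < b)%N) (_ ^+ (b < a)%N) => z w zw.
have -> : z * y * (w * x) = z * w * (x * y) by ring.
by rewrite zw mulN1r opprK.
Qed.

End CechCone.

Section NonzeroWeights.
Variables (k : closedFieldType) (m : nat) (Q : polyFunctor k).
Variables (e : nat) (degQ : has_degree Q e).
Local Notation D := (dim (Q 'rV[k]_m)).
Local Notation E := (pf_bundle Q (cotangent k m)).
Local Opaque emb pfm wt_proj log_ch wcoef.
Local Notation emb := (@emb k m Q).
Local Notation P := (@wt_proj k m Q).
Local Notation C := (@log_ch k m Q).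

Implicit Types (u : expo m) (I J : {set 'I_m.+1}).

Let expoB (u' w : expo m) i : (u' - w) i = u' i - w i.
Proof. by rewrite !ffunE. Qed.

Lemma section_on_emb_sum I u (T : Type) (r : seq T) (F : T -> 'rV[k]_D) :
  (forall x, section_on I (emb u (F x))) -> section_on I (emb u (\sum_(x <- r) F x)).
Proof.
move=> h; elim: r => [|x r IH]; first by rewrite big_nil linear0; apply: section_on0.
rewrite big_cons -[F x]scale1r (emb_lin u 1 (F x) _).
exact: (section_on_submod 1 (h x) IH).
Qed.

Lemma section_on_embZ I u (c : k) v :
  section_on I (emb u v) -> section_on I (emb u (c *: v)).
Proof.
move=> h; rewrite -[c *: v]addr0 (emb_lin u c v 0) linear0.
by apply: section_on_submod => //; apply: section_on0.
Qed.

Lemma wt_component_neq0 (v : 'rV[k]_D) a : v != 0 ->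
  exists w : 'X_{1..m < e.+1}, v *m C 0 a *m P w != 0.
Proof.
move=> nz; apply/existsP; apply: contraNT nz => /existsPn h; apply/eqP.
have z : v *m C 0 a = 0.
  rewrite -[LHS]mulmx1 -(wt_proj_sum m degQ) mulmx_sumr big1 // => w _.
  by apply/eqP; have := h w; rewrite negbK.
by rewrite -[v]mulmx1 -(log_chK Q 0 a) mulmxA z mul0mx.
Qed.

Variables (u : expo m) (nz_u : u != 0) (le_em : (e <= m)%N).
Variables (j : nat) (v : {set 'I_m.+1} -> 'rV[k]_D).
Hypothesis v_sec : forall I, if #|I| == j.+1 then section_on I (emb u (v I)) else v I = 0.
Hypothesis v_closed : forall I, cdiff v I = 0.

Let v_card I : v I != 0 -> #|I| = j.+1 /\ section_on I (emb u (v I)).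
Proof. by have := v_sec I; case: eqP => // _ ->; rewrite eqxx. Qed.

Let v_expo I : v I != 0 -> exists b, b \in I /\ exists w, expo_on I (u - wexpo b w).
Proof.
move=> nz; have [cI hs] := v_card nz.
have [b bI] : exists b, b \in I by apply/set0Pn; rewrite -card_gt0 cI.
exists b; split=> //; have [w hw] := wt_component_neq0 b nz; exists w.
exact: (emb_section_on degQ _ _ bI).1 hs w hw.
Qed.

Let v_deg I : v I != 0 -> \sum_i u i = 0.
Proof.
move/v_expo => [b [_ [w /andP[/eqP h _]]]]; move: h.
under eq_bigr do rewrite expoB.
by rewrite sumrB wexpo_sum subr0.
Qed.

(** If a is outside I and b is in I, regularity in the chart b gives u_a >= w_a >= 0 for some weight
    w. *)
Let v_neg I a : u a < 0 -> v I != 0 -> a \in I.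
Proof.
move=> ua /v_expo[b [bI [w /andP[_ /forallP h]]]]; apply: contraTT ua => aI.
have := h a; rewrite aI /= expoB ffunE; case: unliftP => [c _|e'].
  by rewrite -leNgt; move: (u a : int) => x; lia.
by rewrite e' bI in aI.
Qed.

(** Fix a with u_a < 0. Each weight w of degree e in the chart a admits a vertex b <> a with w_b <=
    u_b, and for sets containing a, adding or removing b does not affect regularity of the part of
    weight w. The cones over these vertices, one for each w, add up to a primitive. The empty set
    has its own clause because sections are taken only over nonempty I. *)
Lemma nonzero_weight_exact : exists t : {set 'I_m.+1} -> 'rV[k]_D,
  [/\ t set0 = 0,
      forall J, if #|J| == j then (J != set0 -> section_on J (emb u (t J))) else t J = 0
    & forall I, v I = cdiff t I].
Proof.
have [v0|/existsNP[I0 /eqP nz0]] := pselect (forall I, v I = 0).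
  exists (fun=> 0); split=> // [J|I]; first by case: eqP => // _ _; rewrite linear0; apply: section_on0.
  by rewrite v0 /cdiff big1 // => a _; rewrite scaler0.
have u0 := v_deg nz0.
(* The entries of u have sum 0 and are not all 0. *)
have [a ua] : exists a, u a < 0.
  apply/existsP; apply: contraNT nz_u => /existsPn h; apply/eqP/ffunP => i.
  have h0 l : 0 <= u l by rewrite leNgt; apply: h.
  by move/eqP: u0; rewrite psumr_eq0 // => /allP/(_ i (mem_index_enum i))/eqP ->; rewrite ffunE.
(* The projection onto weight w in the chart a, written in the logarithmic frame of the chart 0. *)
pose M (w : 'X_{1..m}) : 'M_D := C 0 a *m P w *m C a 0.
pose good (w : 'X_{1..m}) (c : 'I_m) := Posz (w c) <= u (lift a c).
(* Otherwise u_i + 1 <= w_i for all i <> a; summing gives m - u_a <= e, contradicting u_a < 0 and e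
   <= m. *)
have good_ex (w : 'X_{1..m}) : mdeg w = e -> exists c, good w c.
  move=> we; apply/existsP; apply: contraTT ua => /existsPn h.
  have : \sum_c (u (lift a c) + 1) <= \sum_c Posz (w c).
    by apply: ler_sum => c _; have := h c; rewrite /good; move: (u _ : int) => x; lia.
  rewrite -Posz_sum -mdegE we big_split /= sumr_const card_ord.
  move: u0; rewrite (bigD1_ord a) //=; move: (\sum_ _ _) (u a : int) => x y.
  by move: le_em; clear; rewrite -leNgt -mulr_natr mul1r natz; lia.
pose b (w : 'X_{1..m}) : option 'I_m.+1 := omap (lift a) [pick c | good w c].
pose tw (w : 'X_{1..m}) J : 'rV[k]_D :=
  if b w is Some c then cone c (fun I => v I *m M w) J else 0.
have cone_ok w c : b w = Some c -> exists2 c', c = lift a c' & good w c'.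
  by rewrite /b; case: pickP => [c' hc|] //= [<-]; exists c'.
have tw_neq0 w c J : b w = Some c -> tw w J != 0 ->
    [/\ c \notin J, v (c |: J) != 0, #|J| = j & a \in J].
  move=> bw; rewrite /tw bw /cone; case: ifPn => [_|cJ]; first by rewrite eqxx.
  rewrite scaler_eq0 negb_or => /andP[_ nz].
  have nzv : v (c |: J) != 0 by apply: contraNneq nz => ->; rewrite mul0mx.
  have [] := v_card nzv; rewrite cardsU1 cJ => -[cJj] _; split=> //.
  have := v_neg ua nzv; rewrite in_setU1 => /orP[/eqP e'|//].
  by have [c' ec _] := cone_ok _ _ bw; have := neq_lift a c'; rewrite -ec -e' eqxx.
have tw_neq0' w J : tw w J != 0 -> #|J| = j /\ a \in J.
  move=> nz; have := nz; rewrite {1}/tw; case bw : (b w) => [c|]; last by rewrite eqxx.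
  by move=> _; have [] := tw_neq0 _ _ _ bw nz.
exists (fun J => \sum_(w : 'X_{1..m < e.+1}) tw w J); split.
- apply: big1 => w _; apply/eqP; apply: contraT => /tw_neq0'[_].
  by rewrite inE.
- move=> J; case: eqP => [cJ _|nJ]; last first.
    by apply: big1 => w _; apply/eqP; apply: contraT => /tw_neq0'[/nJ].
  apply: section_on_emb_sum => w.
  have [->|nz] := eqVneq (tw w J) 0; first by rewrite linear0; apply: section_on0.
  case bw : (b w) => [c|]; last by rewrite /tw bw eqxx in nz.
  have [cJn nzv _ aJ] := tw_neq0 _ _ _ bw nz.
  have [c' ec hc] := cone_ok _ _ bw.
  rewrite /tw bw /cone (negPf cJn); apply: section_on_embZ.
  apply/(emb_section_on degQ _ _ aJ) => w'.
  have -> : v (c |: J) *m M w *m C 0 a *m P w' = (w == w' :> 'X_{1..m})%:R *: (v (c |: J) *m C 0 a *m P w).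
    by rewrite /M -!mulmxA (mulmxA (C a 0)) log_chK mul1mx wt_proj_mul -!scalemxAr.
  have [<-|_] := eqVneq (w : 'X_{1..m}) w'; last by rewrite mulr0n scale0r eqxx.
  rewrite mulr1n scale1r => nz'; have [_ hs] := v_card nzv.
  have aJ' : a \in c |: J by rewrite inE aJ orbT.
  have /andP[h1 /forallP h2] := (emb_section_on degQ _ _ aJ').1 hs w nz'.
  apply/andP; split=> //; apply/forallP => i; apply/implyP => iJ.
  (* Passing from c |: J to J adds only the condition at c, which holds by the choice of c. *)
  have [->|nic] := eqVneq i c; last first.
    by apply: (implyP (h2 i)); rewrite in_setU1 negb_or nic.
  by rewrite ec expoB wexpo_lift subr_ge0.
move=> I; rewrite /cdiff.
under eq_bigr do rewrite scaler_sumr.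
rewrite exchange_big /= -{1}[v I]mulmx1 -(log_chK Q 0 a) -{1}[C 0 a]mulmx1.
rewrite -(wt_proj_sum m degQ) mulmx_sumr mulmx_suml mulmx_sumr.
apply: eq_bigr => w _; rewrite -/(M w) -/(cdiff (tw w) I) /tw.
(* Without an admissible vertex the degree of w is not e, so the projection onto weight w is 0. *)
case bw : (b w) => [c|]; last first.
  rewrite /cdiff big1 => [|? _]; last by rewrite scaler0.
  rewrite /M (wt_proj_deg degQ) ?mulmx0 ?mul0mx ?mulmx0 //.
  apply/eqP => /good_ex[c hc]; move: bw; rewrite /b; case: pickP => // /(_ c).
  by rewrite hc.
rewrite cdiff_cone // /cdiff.
have := v_closed (c |: I); rewrite /cdiff => /(congr1 (fun x => x *m M w)).
rewrite mul0mx mulmx_suml => h; rewrite -[RHS]h.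
by apply: eq_bigr => x _; rewrite scalemxAl.
Qed.

End NonzeroWeights.

(** * The complex of constant sections *)

Section Bases.
Variable k : fieldType.

(** Take a subspace of maximal dimension inside [Z]: adding the line through an element of [Z]
    cannot enlarge it. *)
Lemma submod_vspace (V : vectType k) (Z : V -> Prop) :
  Z 0 -> (forall c x y, Z x -> Z y -> Z (c *: x + y)) ->
  exists W : {vspace V}, forall x, x \in W <-> Z x.
Proof.
move=> Z0 Zlin.
pose good d := `[< exists2 W : {vspace V}, \dim W = d & forall x, x \in W -> Z x >].
have ex_good : exists d, good d.
  exists 0%N; apply/asboolP; exists 0%VS; rewrite ?dimv0 // => x.
  by rewrite memv0 => /eqP ->.
have ub_good d : good d -> (d <= \dim {:V})%N.
  by case/asboolP => W <- _; apply/dimvS/subvf.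
case: (ex_maxnP ex_good ub_good) => d /asboolP[W dW hW] maxd.
exists W => x; split=> [|Zx]; first exact: hW.
have : good (\dim (W + <[x]>)).
  apply/asboolP; exists (W + <[x]>)%VS => // y /memv_addP[y1 h1 [y2 /vlineP[c ->] ->]].
  by rewrite addrC; apply: Zlin => //; apply: hW.
move/maxd; rewrite -dW => le.
have : (W == W + <[x]>)%VS by rewrite eqEdim addvSl.
by move/eqP->; apply/(subvP (addvSr _ _))/memv_line.
Qed.

(** The classes of the [w i] form a basis of Z / B; avoiding the quotient makes this easy to carry
    along semilinear maps. *)
Definition quot_basis (V : lmodType k) (Z B : V -> Prop) n (w : 'I_n -> V) :=
  [/\ forall i, Z (w i),
      forall z, Z z -> exists c : 'I_n -> k, B (z - \sum_i c i *: w i)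
    & forall c : 'I_n -> k, B (\sum_i c i *: w i) -> forall i, c i = 0].

(** A basis of a complement of B in Z does it. *)
Lemma quot_basis_exists (V : vectType k) (Z B : V -> Prop) :
  Z 0 -> (forall c x y, Z x -> Z y -> Z (c *: x + y)) ->
  B 0 -> (forall c x y, B x -> B y -> B (c *: x + y)) ->
  (forall x, B x -> Z x) -> exists n (w : 'I_n -> V), quot_basis Z B w.
Proof.
move=> Z0 Zlin B0 Blin BZ.
have [WZ hZ] := submod_vspace Z0 Zlin; have [WB hB] := submod_vspace B0 Blin.
pose T := (WZ :\: WB)%VS; pose b := vbasis T.
have bT i : b`_i \in T.
  have [lt|ge] := ltnP i (size b); last by rewrite nth_default ?mem0v.
  by apply: vbasis_mem; apply: mem_nth.
exists (\dim T), (fun i => b`_i); split=> [i|z /hZ zZ|c /hB hc].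
- by apply/hZ/(subvP (diffvSl WZ WB)).
- move: zZ; rewrite -{1}(addv_diff_cap WZ WB) => /memv_addP[z1 h1 [z2 h2 ->]].
  exists (fun i => coord b i z1); rewrite -(coord_vbasis h1) addrAC subrr add0r.
  by apply/hB; move: h2; rewrite memv_cap => /andP[].
move=> i; have /freeP : free b by apply: basis_free (vbasisP T).
apply; apply/eqP; rewrite -memv0 -(capv_diff WZ WB) memv_cap hc andbT.
by apply: memv_suml => l _; apply: memvZ.
Qed.

Definition is_basis (H : lmodType k) n (e : 'I_n -> H) :=
  (forall x, exists c : 'I_n -> k, x = \sum_i c i *: e i) /\
  (forall c : 'I_n -> k, \sum_i c i *: e i = 0 -> forall i, c i = 0).

Section TwoBases.
Variables (H H' : lmodType k) (n : nat) (e : 'I_n -> H) (e' : 'I_n -> H').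
Hypotheses (eP : is_basis e) (eP' : is_basis e').

Let co x := sval (cid (eP.1 x)).

Let coE x : x = \sum_i co x i *: e i.
Proof. by rewrite /co; case: cid. Qed.

Definition basis_change (x : H) : H' := \sum_i co x i *: e' i.

Let co_uniq x (c : 'I_n -> k) : x = \sum_i c i *: e i -> co x =1 c.
Proof.
move=> h i; apply/eqP; rewrite -subr_eq0; apply/eqP; move: i; apply: eP.2.
under eq_bigr do rewrite scalerBl.
by rewrite sumrB -coE -h subrr.
Qed.

Fact basis_change_linear : linear basis_change.
Proof.
move=> a x y; rewrite /basis_change scaler_sumr -big_split; apply: eq_bigr => i _ /=.
rewrite (co_uniq (c := fun i => a * co x i + co y i)); first by rewrite scalerDl scalerA.
rewrite {1}(coE x) {1}(coE y) scaler_sumr -big_split; apply: eq_bigr => l _ /=.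
by rewrite scalerDl scalerA.
Qed.

HB.instance Definition _ :=
  GRing.isLinear.Build k H H' _ basis_change basis_change_linear.

Lemma lmod_iso_bases : lmod_iso H H'.
Proof.
exists basis_change; pose co' y := sval (cid (eP'.1 y)).
have coE' y : y = \sum_i co' y i *: e' i by rewrite /co'; case: cid.
exists (fun y => \sum_i co' y i *: e i) => [x|y].
  rewrite [RHS](coE x); apply: eq_bigr => i _; congr (_ *: _).
  apply/eqP; rewrite -subr_eq0; apply/eqP; move: i; apply: eP'.2.
  under eq_bigr do rewrite scalerBl.
  by rewrite sumrB -coE' subrr.
rewrite [RHS](coE' y) /basis_change; apply: eq_bigr => i _.
by rewrite (co_uniq (c := co' y)).
Qed.

End TwoBases.
End Bases.

Lemma eq_subl (Z : zmodType) (x a b : Z) : x = a + b -> x - a = b.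
Proof. by move=> ->; rewrite addrAC subrr add0r. Qed.

Lemma lquot_basis (k : fieldType) (V : lmodType k) (B : {pred V}) (hB : submod_closed B)
    n (w : 'I_n -> V) :
  quot_basis (fun=> True) (fun x => x \in B) w ->
  is_basis (fun i => \pi_(Quotient.quot (lquot_by hB))%qT (w i) : lquot hB).
Proof.
case=> _ h1 h2; pose cls (x : V) : lquot hB := \pi_(Quotient.quot (lquot_by hB))%qT x.
have clsD x y : cls (x + y) = cls x + cls y by apply: lquot_clsD.
have cls0 : cls 0 = 0 by apply: (addrI (cls 0)); rewrite -clsD !addr0.
have clsE x y : cls x = cls y <-> x - y \in B by apply: (lquot_clsE hB).
have cls_sum c : \sum_i c i *: cls (w i) = cls (\sum_i c i *: w i).
  by rewrite (big_morph cls clsD cls0); apply: eq_bigr => i _; apply: lquot_scale_cls.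
split=> [|c].
  elim/lquot_ind => x; have [c hc] := h1 x I; exists c.
  by apply: etrans (esym (cls_sum c)); apply/clsE.
by rewrite [X in X = _ -> _]cls_sum -cls0 => /clsE; rewrite subr0; apply: h2.
Qed.

(** * Reduction of cohomology to weight 0 *)

Section ConstantComplex.
Variables (k : closedFieldType) (m : nat) (Q : polyFunctor k).
Variables (e : nat) (degQ : has_degree Q e).
Local Notation D := (dim (Q 'rV[k]_m)).
Local Notation E := (pf_bundle Q (cotangent k m)).
Local Opaque emb pfm wt_proj log_ch wcoef.
Local Notation emb := (@emb k m Q).
Local Notation wcoef := (@wcoef k m Q).
Local Notation X := ('rV[k]_D).

Implicit Types (u : expo m) (I J : {set 'I_m.+1}).

(** All families are allowed, and the cochain conditions are imposed as predicates, so that the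
    ambient space is finite-dimensional and independent of j. *)
Definition const_cochains : vectType k := {ffun {set 'I_m.+1} -> 'rV[k]_D}.
Implicit Types (v t : const_cochains).

Definition const_cochain j v := forall I : {set 'I_m.+1},
  if #|I| == j.+1 then section_on I (emb 0 (v I)) else v I = 0.

Definition const_diff v : const_cochains := [ffun I => cdiff v I].

Definition const_cocycle j v := const_cochain j v /\ const_diff v = 0.

(* Requiring a cocycle saves proving that the differential squares to 0. *)
Definition const_coboundary j v := const_cocycle j v /\
  if j is i.+1 then exists2 t, const_cochain i t & v = const_diff t else v = 0.

Definition emb_cochain u (v : {set 'I_m.+1} -> X) : ratcochain E :=
  [ffun I => emb u (v I)].

Lemma emb_cochainE u (v : {set 'I_m.+1} -> X) I : emb_cochain u v I = emb u (v I).
Proof. exact: ffunE. Qed.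

Lemma emb_cochain_ext u (v v' : {set 'I_m.+1} -> X) :
  v =1 v' -> emb_cochain u v = emb_cochain u v'.
Proof. by move/funext->. Qed.

Lemma cech_diffE (s : ratcochain E) I : cech_diff s I = cdiff s I.
Proof. exact: ffunE. Qed.

Lemma const_diffE v I : const_diff v I = cdiff v I.
Proof. exact: ffunE. Qed.

Local Opaque emb_cochain const_diff.

Lemma const_cochain0 j : const_cochain j 0.
Proof.
move=> I; rewrite ffunE; case: eqP => // _; rewrite linear0; exact: section_on0.
Qed.

Lemma const_cochain_lin j c v t :
  const_cochain j v -> const_cochain j t -> const_cochain j (c *: v + t).
Proof.
move=> hv ht I; have := hv I; have := ht I; rewrite !ffunE; case: eqP => _.
  by rewrite (emb_lin 0 c (v I) (t I)) => h1 h2; apply: (section_on_submod c h2 h1).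
by move=> -> ->; rewrite scaler0 addr0.
Qed.

Lemma const_diff_lin c v t : const_diff (c *: v + t) = c *: const_diff v + const_diff t.
Proof.
apply/ffunP => I; rewrite !ffunE /cdiff scaler_sumr -big_split; apply: eq_bigr => a _ /=.
by rewrite !ffunE scalerDr !scalerA mulrC.
Qed.

Lemma const_diff0 : const_diff 0 = 0.
Proof. by apply/ffunP => I; rewrite const_diffE ffunE /cdiff big1 // => a _; rewrite ffunE scaler0. Qed.

Lemma const_cocycle0 j : const_cocycle j 0.
Proof. by split; [apply: const_cochain0 | apply: const_diff0]. Qed.

Lemma const_cocycle_lin j c v t :
  const_cocycle j v -> const_cocycle j t -> const_cocycle j (c *: v + t).
Proof.
move=> [v1 v2] [t1 t2]; split; first exact: const_cochain_lin.
by rewrite const_diff_lin v2 t2 scaler0 addr0.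
Qed.

Lemma const_coboundary0 j : const_coboundary j 0.
Proof.
split; first exact: const_cocycle0.
by case: j => [//|i]; exists 0; [apply: const_cochain0 | rewrite const_diff0].
Qed.

Lemma const_coboundary_lin j c v t :
  const_coboundary j v -> const_coboundary j t -> const_coboundary j (c *: v + t).
Proof.
move=> [v1 v2] [t1 t2]; split; first exact: const_cocycle_lin.
case: j {v1 t1} v2 t2 => [-> ->|i]; first by rewrite scaler0 addr0.
move=> [v' hv ->] [t' ht ->]; exists (c *: v' + t'); first exact: const_cochain_lin.
by rewrite const_diff_lin.
Qed.

Lemma emb_sum u (T : Type) (r : seq T) (P : pred T) (F : T -> X) (c : T -> k) :
  emb u (\sum_(x <- r | P x) c x *: F x) = \sum_(x <- r | P x) c x *: emb u (F x).
Proof.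
elim: r => [|x r IH]; first by rewrite !big_nil linear0.
by rewrite !big_cons; case: (P x) => //; rewrite (emb_lin u (c x) (F x) _) IH.
Qed.

Lemma cech_diff_emb u (v : {set 'I_m.+1} -> X) :
  cech_diff (emb_cochain u v) = emb_cochain u (cdiff v).
Proof.
apply/ffunP => I; rewrite cech_diffE emb_cochainE emb_sum; apply: eq_bigr => a _.
by rewrite emb_cochainE.
Qed.

Lemma cech_diffD : {morph @cech_diff k m E : s t / s + t}.
Proof.
by move=> s t; have := cech_diff_linear 1 s t; rewrite !scale1r.
Qed.

Lemma emb_cochain_lin u c v t :
  emb_cochain u (c *: v + t) = c *: emb_cochain u v + emb_cochain u t.
Proof.
apply/ffunP => I.
have r : (c *: v + t) I = c *: v I + t I by rewrite !ffunE.
have r' (x y : ratcochain E) : (c *: x + y) I = c *: x I + y I by rewrite !ffunE.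
apply: etrans (emb_cochainE _ _ _) _; rewrite r.
apply: etrans (emb_lin _ _ _ _) _; apply/esym; apply: etrans (r' _ _) _.
by congr (_ *: _ + _); apply: emb_cochainE.
Qed.

Lemma emb_cochainB u v t : emb_cochain u (v - t) = emb_cochain u v - emb_cochain u t.
Proof.
have := emb_cochain_lin u (-1) t v; rewrite !scaleN1r addrC => ->.
exact: addrC.
Qed.

Lemma emb_cochainP j v : const_cochain j v -> cochain j (emb_cochain 0 v).
Proof.
move=> h I; have := h I; rewrite emb_cochainE; case: eqP => // _ ->.
by rewrite linear0.
Qed.

Lemma emb_const_diff v : emb_cochain 0 (const_diff v) = cech_diff (emb_cochain 0 v).
Proof. rewrite cech_diff_emb; apply/ffunP => I.
apply: etrans (emb_cochainE _ _ _) _; apply/esym; apply: etrans (emb_cochainE _ _ _) _.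
by rewrite const_diffE.
Qed.

Lemma emb_cochain0 : emb_cochain 0 (0 : const_cochains) = 0.
Proof. by apply/ffunP => I; rewrite emb_cochainE !ffunE linear0. Qed.

Lemma emb_cocycle j v : const_cocycle j v -> emb_cochain 0 v \in is_cocycle j.
Proof.
case=> h1 h2; apply/asboolP; split; first exact: emb_cochainP.
by rewrite -emb_const_diff h2 emb_cochain0.
Qed.

Lemma emb_coboundary j v : const_coboundary j v -> emb_cochain 0 v \in is_coboundary j.
Proof.
case=> _ h; apply/asboolP; case: j h => [->|i [t ht ->]]; first exact: emb_cochain0.
by exists (emb_cochain 0 t); [apply: emb_cochainP | apply: emb_const_diff].
Qed.

Lemma cochain_torus j (s : ratcochain E) I : cochain j s -> torus_section (s I).
Proof.
move=> h; have := h I; case: eqP => [cI hs|_ ->]; last exact: torus_section0.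
have [a aI] : exists a, a \in I by apply/set0Pn; rewrite -card_gt0 cI.
exact: (section_torus degQ aI hs).
Qed.

Lemma cochain_expand j (s : ratcochain E) : cochain j s ->
  exists S : seq (expo m), [/\ uniq S, 0 \in S &
    s = \sum_(u <- S) emb_cochain u (fun I => wcoef u (s I))].
Proof.
move=> hs; have hT I : torus_section (s I) by apply: cochain_torus hs.
have [S [uS S0 hS]] := torus_section_expand hT; exists S; split=> //.
apply/ffunP => I; rewrite sum_ffunE {1}(hS I); apply: eq_bigr => u _.
by rewrite emb_cochainE.
Qed.

Lemma wcoef_cochain j (s : ratcochain E) u : cochain j s ->
  forall I : {set 'I_m.+1}, if #|I| == j.+1 then section_on I (emb u (wcoef u (s I)))
                           else wcoef u (s I) = 0.
Proof.
move=> hs I; have := hs I; case: eqP => [cI h|_ ->]; last exact: wcoef0.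
have [a aI] : exists a, a \in I by apply/set0Pn; rewrite -card_gt0 cI.
exact: (wcoef_section_on degQ u aI h).
Qed.

Lemma wcoef_diff j (s : ratcochain E) u I : cochain j s ->
  cdiff (fun J => wcoef u (s J)) I = wcoef u (cech_diff s I).
Proof.
move=> hs; rewrite cech_diffE /cdiff; apply/esym.
by apply: wcoef_sum => a; apply: cochain_torus hs.
Qed.

Hypothesis le_em : (e <= m)%N.

(** A cocycle is the finite sum of its weight components, which are cocycles; those of nonzero
    weight are coboundaries by [nonzero_weight_exact]. *)
Lemma cocycle_const j (s : ratcochain E) : s \in is_cocycle j ->
  exists2 v, const_cocycle j v & s - emb_cochain 0 v \in is_coboundary j.
Proof.
case/asboolP => hs ds.
have [v vE] : exists v : expo m -> const_cochains, forall u I, v u I = wcoef u (s I).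
  by exists (fun u => [ffun I => wcoef u (s I)]) => u I; apply: ffunE.
have v_sec u I : if #|I| == j.+1 then section_on I (emb u (v u I)) else v u I = 0.
  by rewrite vE; apply: wcoef_cochain.
have v_closed u I : cdiff (v u) I = 0.
  transitivity (cdiff (fun J => wcoef u (s J)) I).
    by apply: eq_bigr => a _; rewrite vE.
  rewrite (wcoef_diff u I hs) ds.
  have -> : (0 : ratcochain E) I = 0 by exact: ffunE.
  exact: wcoef0.
exists (v 0).
  split; first exact: v_sec.
  by apply/ffunP => I; apply: etrans (const_diffE _ _) _; rewrite v_closed; apply/esym/ffunE.
have [S [uS S0 sE]] := cochain_expand hs.
have {}sE : s - emb_cochain 0 (v 0) = \sum_(u <- S | u != 0) emb_cochain u (v u).
  apply: eq_subl; rewrite [LHS]sE -(bigD1_seq (F := fun u => emb_cochain u (v u)) _ S0 uS) /=.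
  by apply: eq_bigr => u _; apply: emb_cochain_ext => I; rewrite vE.
have /choice[t ht] u : exists t : {set 'I_m.+1} -> X, u != 0 ->
   [/\ t set0 = 0,
      forall J, if #|J| == j then (J != set0 -> section_on J (emb u (t J))) else t J = 0
    & forall I, v u I = cdiff t I].
  have [->|nz] := eqVneq u 0; first by exists (fun=> 0).
  by have [t ht] := nonzero_weight_exact degQ nz le_em (v_sec u) (v_closed u); exists t.
apply/asboolP; rewrite sE; case: j {hs ds v_sec v_closed} ht => [|i] ht.
  (* For j = 0 the primitive lives on the empty set, where it is 0, so the components of nonzero
     weight vanish. *)
  apply: big1 => u nz; have [t0 tJ vt] := ht u nz.
  apply/ffunP => I; rewrite emb_cochainE vt [RHS]ffunE /cdiff big1 ?linear0 // => a _.
  have -> : t u (I :\ a) = 0; last by rewrite scaler0.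
  have [->//|ne] := eqVneq (I :\ a) set0.
  by have := tJ (I :\ a); rewrite cards_eq0 (negPf ne).
exists (\sum_(u <- S | u != 0) emb_cochain u (t u)).
  elim/big_rec: _ => [|u x nz hx]; first exact: cochain0.
  have [t0 tJ vt] := ht u nz; rewrite -[emb_cochain _ _]scale1r; apply: cochain_submod hx => J.
  rewrite emb_cochainE; have := tJ J; case: eqP => [cJ|_ ->]; last by rewrite linear0.
  by apply; rewrite -card_gt0 cJ.
rewrite (big_morph _ cech_diffD (cech_diff0 _)); apply: eq_bigr => u nz.
have [t0 tJ vt] := ht u nz; rewrite cech_diff_emb.
exact: emb_cochain_ext.
Qed.

(** The weight 0 component commutes with the differential, so that of a primitive is again a
    primitive. *)
Lemma const_coboundary_emb j v : const_cocycle j v ->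
  emb_cochain 0 v \in is_coboundary j -> const_coboundary j v.
Proof.
move=> hv /asboolP h; split=> //.
have wE I : v I = wcoef 0 (emb_cochain 0 v I).
  by rewrite emb_cochainE wcoef_emb eqxx scale1r.
case: j hv h => [_ h|i _ [t ht h]].
  by apply/ffunP => I; rewrite wE h [in LHS]ffunE [RHS]ffunE; apply: wcoef0.
exists [ffun I => wcoef 0 (t I)].
  by move=> I; rewrite ffunE; apply: wcoef_cochain.
apply/ffunP => I; rewrite wE h -(wcoef_diff 0 I ht) const_diffE.
by apply: eq_bigr => a _; rewrite ffunE.
Qed.

(** [cocycle_const] gives generation, [const_coboundary_emb] independence. *)
Lemma cohomology_basis j n (w : 'I_n -> const_cochains) :
  quot_basis (const_cocycle j) (const_coboundary j) w ->
  exists e : 'I_n -> cohomology E j, is_basis e.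
Proof.
case=> hw hspan hfree; pose W i := Cocycle (emb_cocycle (hw i)).
exists (fun i => \pi_(Quotient.quot (lquot_by (@coboundary_submod _ _ E j)))%qT (W i) : cohomology E j).
apply: (lquot_basis (coboundary_submod E j)).
have valD : {morph @cocycle_val k m E j : x y / x + y} by [].
have valZ c : {morph @cocycle_val k m E j : x / c *: x} by [].
have val0 : @cocycle_val k m E j 0 = 0 by [].
have Wsum (c : 'I_n -> k) :
    cocycle_val (\sum_i c i *: W i) = emb_cochain 0 (\sum_i c i *: w i).
  rewrite (big_morph _ valD val0).
  elim/big_rec2: _ => [|i x y _ ->]; first by rewrite emb_cochain0.
  by rewrite emb_cochain_lin valZ.
split=> // [z _|c hc].
  have [v hv hz] := cocycle_const (cocycle_valP z); have [c hc] := hspan v hv; exists c.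
  have [_ h] := is_coboundary_submod E j.
  have := h 1 _ _ hz (emb_coboundary hc); rewrite scale1r emb_cochainB -Wsum.
  rewrite addrA subrK.
  exact.
apply: hfree; apply: const_coboundary_emb; last by rewrite -Wsum.
elim/big_rec: _ => [|i x _ hx]; first exact: const_cocycle0.
exact: const_cocycle_lin.
Qed.

End ConstantComplex.

(** * Comparison of constant complexes *)

Section Restriction.
Variables (k : closedFieldType) (m : nat).

Definition chi (R : pzRingType) (I : {set 'I_m.+1}) a : 'rV[R]_m :=
  \row_c (lift a c \in I)%:R.

(* Kills d log (x_c / x_a) for c outside I. *)
Definition restr (R : pzRingType) I a : 'M[R]_m :=
  log_mx R 0 a *m diag_mx (chi R I a) *m log_mx R a 0.

Lemma map_restr (R R' : pzRingType) (phi : {rmorphism R -> R'}) I a :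
  map_mx phi (restr R I a) = restr R' I a.
Proof.
rewrite /restr !map_mxM !map_log_mx map_diag_mx; congr (_ *m diag_mx _ *m _).
by apply/rowP => c; rewrite !mxE rmorph_nat.
Qed.

(** A 0-1 vector raised to the power w is 1 exactly when w is supported in I, and this is what
    regularity over U_I of the inverse of the monomial [wexpo a w] means. *)
Lemma mmap1_chi (I : {set 'I_m.+1}) a (w : 'X_{1..m}) : a \in I ->
  mmap1 (chi k I a 0) w = (expo_on I (0 - wexpo a w))%:R.
Proof.
move=> aI; have expoE i : (0 - wexpo a w) i = - wexpo a w i by rewrite sub0r [LHS]ffunE.
have -> : expo_on I (0 - wexpo a w) = [forall c, (lift a c \notin I) ==> (w c == 0%N)].
  rewrite /expo_on; under eq_bigr do rewrite expoE.
  rewrite sumrN wexpo_sum oppr0 eqxx /=; apply/forallP/forallP => h.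
    move=> c; apply/implyP => cI; have := implyP (h (lift a c)) cI.
    by rewrite expoE wexpo_lift; lia.
  move=> i; apply/implyP; case: (unliftP a i) => [c|] -> iI; last by rewrite aI in iI.
  by have := implyP (h c) iI; rewrite expoE wexpo_lift => /eqP ->.
case: forallP => [h|h] /=.
  rewrite /mmap1 big1 // => c _; rewrite mxE; have := h c.
  by case: (_ \in I) => /= [_|/eqP ->]; rewrite ?expr1n ?expr0.
have /existsNP[c hc] := h; apply/eqP/prodf_eq0; exists c => //.
move: hc => /negP; rewrite negb_imply mxE => /andP[/negPf -> nz].
by rewrite expr0n (negPf nz).
Qed.

Variables (Q : polyFunctor k) (e : nat) (degQ : has_degree Q e).
Local Notation C := (@log_ch k m Q).

(** Q applied to the 0-1 diagonal matrix of I is the sum of the projections onto the weights regular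
    on U_I; a vector is fixed by it iff it has only such weights. *)
Lemma const_sectionP (I : {set 'I_m.+1}) a (v : 'rV[k]_(dim (Q 'rV[k]_m))) : a \in I ->
  section_on I (emb 0 v) <-> v *m pfm Q idfun (restr k I a) = v.
Proof.
move=> aI; set y := v *m C 0 a; set G := pfm Q idfun (diag_mx (chi k I a)).
have GE : G = \sum_(w : 'X_{1..m < e.+1})
    (expo_on I (0 - wexpo a w))%:R *: wt_proj Q w.
  rewrite /G (pfm_diag degQ idfun); apply: eq_bigr => w _.
  by rewrite mmap1_chi // map_mx_id.
have -> : (v *m pfm Q idfun (restr k I a) = v) <-> (y *m G = y).
  have -> : v *m pfm Q idfun (restr k I a) = y *m G *m C a 0.
    by rewrite /y /restr !(pfmM Q idfun) !mulmxA.
  split=> [h|->]; last by rewrite /y -mulmxA log_chK mulmx1.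
  by move: h => /(congr1 (fun x => x *m C 0 a)); rewrite -mulmxA log_chK mulmx1.
rewrite (emb_section_on degQ _ _ aI) -/y; split=> h.
  rewrite GE mulmx_sumr -[RHS]mulmx1 -(wt_proj_sum m degQ) mulmx_sumr.
  apply: eq_bigr => w _; have [z|nz] := eqVneq (y *m wt_proj Q w) 0.
    by rewrite -scalemxAr z scaler0.
  by rewrite (h w nz) scale1r.
move=> w; apply: contraNT => nreg; rewrite -h GE -mulmxA mulmx_suml (bigD1 w) //=.
rewrite (negPf nreg) scale0r mul0mx add0r big1 ?mulmx0 // => w' nw.
rewrite -scalemxAl wt_proj_mul (inj_eq val_inj) (negPf nw).
by rewrite mulr0n scale0r scaler0.
Qed.

End Restriction.

(** * Transport of weight 0 cohomology along semilinear bijections *)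

Section Transport.
Variables (k : closedFieldType) (m : nat) (Q Q' : polyFunctor k) (e e' : nat).
Hypotheses (degQ : has_degree Q e) (degQ' : has_degree Q' e').
Local Notation D := (dim (Q 'rV[k]_m)).
Local Notation D' := (dim (Q' 'rV[k]_m)).
Variables (sigma : {rmorphism k -> k}) (th : 'rV[k]_D -> 'rV[k]_D').
Hypotheses (sigma_surj : forall y, exists x, sigma x = y)
  (thD : {morph th : x y / x + y}) (thZ : forall c x, th (c *: x) = sigma c *: th x)
  (th_bij : bijective th)
  (th_restr : forall I a v, th (v *m pfm Q idfun (restr k I a))
                = th v *m pfm Q' idfun (restr k I a)).
Local Notation CC := (const_cochains m Q).
Local Notation CC' := (const_cochains m Q').
Local Opaque emb pfm.

Let th0 : th 0 = 0.
Proof. by rewrite -(scale0r 0) thZ rmorph0 scale0r. Qed.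

Let Th (v : CC) : CC' := [ffun I => th (v I)].

Let ThD : {morph Th : x y / x + y}.
Proof. by move=> x y; apply/ffunP => I; rewrite !ffunE thD. Qed.

Let ThZ c x : Th (c *: x) = sigma c *: Th x.
Proof. by apply/ffunP => I; rewrite !ffunE thZ. Qed.

Let Th0 : Th 0 = 0.
Proof. by apply/ffunP => I; rewrite !ffunE th0. Qed.

Let Th_bij : bijective Th.
Proof.
have [g gK Kg] := th_bij.
by exists (fun v : CC' => [ffun I => g (v I)] : CC) => v; apply/ffunP => I; rewrite !ffunE ?gK ?Kg.
Qed.

Let Th_cochain j v : const_cochain j (Th v) <-> const_cochain j v.
Proof.
suff H (I : {set 'I_m.+1}) : (if #|I| == j.+1 then section_on I (emb 0 (Th v I)) else Th v I = 0)
    <-> (if #|I| == j.+1 then section_on I (emb 0 (v I)) else v I = 0).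
  by split=> h I; apply/H/h.
have -> : Th v I = th (v I) by exact: ffunE.
case: eqP => [cI|_]; last by split=> [|->//]; rewrite -{1}th0; apply: bij_inj.
have [a aI] : exists a, a \in I by apply/set0Pn; rewrite -card_gt0 cI.
rewrite (const_sectionP degQ _ aI) (const_sectionP degQ' _ aI) -th_restr.
by split=> [|->//]; apply: bij_inj.
Qed.

Let Th_diff v : const_diff (Th v) = Th (const_diff v).
Proof.
apply/ffunP => I; rewrite !ffunE /cdiff (big_morph th thD th0).
by apply: eq_bigr => a _; rewrite thZ rmorph_sign ffunE.
Qed.

Let Th_cocycle j v : const_cocycle j (Th v) <-> const_cocycle j v.
Proof.
rewrite /const_cocycle Th_cochain Th_diff; split=> -[h1 h2]; split=> //.
  by apply: (bij_inj Th_bij); rewrite h2 Th0.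
by rewrite h2 Th0.
Qed.

Let Th_coboundary j v : const_coboundary j (Th v) <-> const_coboundary j v.
Proof.
rewrite /const_coboundary Th_cocycle; split=> -[h1 h2]; split=> //; case: j {h1} h2 => [h|i [t ht h]].
- by apply: (bij_inj Th_bij); rewrite h Th0.
- have [g gK Kg] := Th_bij; exists (g t); first by apply/Th_cochain; rewrite Kg.
  by apply: (bij_inj Th_bij); rewrite -Th_diff Kg.
- by rewrite h Th0.
by exists (Th t); [apply/Th_cochain | rewrite Th_diff h].
Qed.

Lemma quot_basis_transport j n (w : 'I_n -> CC) :
  quot_basis (const_cocycle j) (const_coboundary j) w ->
  exists w' : 'I_n -> CC', quot_basis (const_cocycle j) (const_coboundary j) w'.
Proof.
case=> hw hspan hfree; exists (fun i => Th (w i)).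
have Th_sum c : \sum_i sigma (c i) *: Th (w i) = Th (\sum_i c i *: w i).
  by rewrite (big_morph Th ThD Th0); apply: eq_bigr => i _; rewrite ThZ.
split=> [i|z hz|c hc]; first exact/Th_cocycle.
  have [g gK Kg] := Th_bij; have [|c hc] := hspan (g z); first by apply/Th_cocycle; rewrite Kg.
  exists (fun i => sigma (c i)); rewrite Th_sum -{1}(Kg z) -scaleN1r -(rmorphN1 sigma) -ThZ -ThD scaleN1r.
  exact/Th_coboundary.
(* The coefficients of a relation must be values of sigma before it can be pulled back. *)
have /choice[d dc] i : exists x, sigma x = c i by apply: sigma_surj.
have := hc; under eq_bigr do rewrite -dc.
by rewrite Th_sum => /Th_coboundary/hfree d0 i; rewrite -dc d0 rmorph0.
Qed.

End Transport.

(** * The two bijections coming from the Frobenius functor *)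

Section Comparison.
Variables (k : closedFieldType) (p : nat) (pcharkp : p \in [pchar k]).
Local Notation F := (frobenius pcharkp).

Let phi : {rmorphism k -> k} := pFrobenius_aut pcharkp.

Let phiE x : phi x = x ^+ p.
Proof. exact: pFrobenius_autE. Qed.

Let pchar_mpoly n : p \in [pchar {mpoly k[n]}].
Proof. exact: (rmorph_pchar (@mpolyC n k)). Qed.

Let phi_surj y : exists x, phi x = y.
Proof. by have [x ->] := root_exists pcharkp y; exists x. Qed.

(** The p-th power map, a bijection that is natural in V and semilinear over the Frobenius of k. *)
Definition frob_pow (V : vectType k) (v : V) : frob pcharkp V :=
  Frob (asboolT (ex_intro (fun u : V => symv v ^+ p = symv u ^+ p) v erefl)).

Lemma frob_val_pow (V : vectType k) (v : V) : frob_val (frob_pow v) = symv v ^+ p.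
Proof. by []. Qed.

Lemma frob_coord_pow (V : vectType k) (v : V) i :
  frob_coord (frob_pow v) 0 i = v2r v 0 i ^+ p.
Proof.
pose r := \row_l (v2r v 0 l ^+ p); rewrite mxE frob_val_pow (symvXp pcharkp).
rewrite (eq_bigr (fun l => r 0 l *: 'X_l ^+ p)); first by rewrite mcoeff_frob // mxE.
by move=> l _; rewrite mxE.
Qed.

Lemma frob_powD (V : vectType k) : {morph @frob_pow V : u v / u + v}.
Proof.
move=> u v; apply/val_inj; rewrite /= symvD.
by rewrite -[LHS](pFrobenius_autE (pchar_mpoly _)) rmorphD /= !pFrobenius_autE.
Qed.

Lemma frob_powZ (V : vectType k) c (v : V) : frob_pow (c *: v) = phi c *: frob_pow v.
Proof. by apply/val_inj; rewrite /= symvZ exprZn phiE. Qed.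

Lemma frob_pow_bij (V : vectType k) : bijective (@frob_pow V).
Proof.
have inj : injective (@frob_pow V).
  move=> u v e; apply: (can_inj v2rK); apply/rowP => i; apply: (fmorph_inj phi).
  by rewrite !phiE -!frob_coord_pow e.
pose g (q : frob pcharkp V) : V := sval (cid (frobP q)).
have gP q : frob_pow (g q) = q.
  by apply/val_inj; rewrite /= /g; case: cid.
by exists g => // v; apply: inj; rewrite gP.
Qed.

Lemma frob_map_pow (V W : vectType k) (f : 'Hom(V, W)) v :
  frob_map pcharkp f (frob_pow v) = frob_pow (f v).
Proof. by apply/val_inj/frob_map_symv. Qed.

Lemma frobenius_degree : has_degree F p.
Proof.
move=> V c; apply/lfunP => q; have [v ->] : exists v, q = frob_pow v.
  by have [g _ Kg] := @frob_pow_bij V; exists (g q); rewrite Kg.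
rewrite [LHS](frob_map_pow (c *: \1%VF) v) !scale_lfunE !id_lfunE frob_powZ.
by rewrite phiE.
Qed.

Lemma degree_comp (P Q : polyFunctor k) d e :
  has_degree P d -> has_degree Q e -> has_degree (pfcomp P Q) (d * e).
Proof.
move=> hP hQ V c; transitivity (pf_map P (pf_map Q (c *: (\1 : 'Hom(V, V))%VF))) => //.
by rewrite hQ hP -exprM mulnC.
Qed.

Variable m : nat.
Local Notation V := 'rV[k]_m.

Lemma pfmE (Q : polyFunctor k) (A : 'M[k]_m) (v : 'rV[k]_(dim (Q V))) :
  v *m pfm Q idfun A = v2r (pf_map Q (Hom (rmulmx k A) : 'Hom(V, V)) (r2v v)).
Proof. by rewrite f2mxE r2vK poly_lawP. Qed.

Section Functor.
Variable P : polyFunctor k.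

Let twist (v : 'rV[k]_(dim (P V))) : 'rV[k]_(dim (pfcomp F P V)) :=
  v2r (frob_pow (r2v v)).

(** Naturality of [frob_pow] with respect to P(A) gives compatibility with every matrix A. *)
Lemma quot_basis_frob_comp d e j n (w : 'I_n -> const_cochains m P) :
  has_degree P d -> has_degree (pfcomp F P) e ->
  quot_basis (const_cocycle j) (const_coboundary j) w ->
  exists w' : 'I_n -> const_cochains m (pfcomp F P),
    quot_basis (const_cocycle j) (const_coboundary j) w'.
Proof.
move=> hd he; apply: (quot_basis_transport hd he (sigma := phi) (th := twist)) => //.
- by move=> x y; rewrite /twist linearD frob_powD linearD.
- by move=> c x; rewrite /twist linearZ /= frob_powZ linearZ.
- have [g gK Kg] := @frob_pow_bij (P V).
  exists (fun v => v2r (g (r2v v))) => v; rewrite /twist v2rK ?gK ?Kg; exact: r2vK.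
move=> I a v; rewrite !pfmE /twist !v2rK; congr v2r.
by apply/esym; apply: frob_map_pow.
Qed.

(** The linear isomorphism taking e_i to e_i^p; it depends on the basis. *)
Let kap_fun (v : V) : frob pcharkp V := Frob (@frob_sum_proof k p pcharkp V (v2r v)).

Let kap_fun_linear : linear kap_fun.
Proof.
move=> c u v; apply/val_inj; rewrite /= linearP scaler_sumr -big_split.
by apply: eq_bigr => i _; rewrite !mxE scalerDl scalerA.
Qed.

HB.instance Definition _ :=
  GRing.isLinear.Build k V (frob pcharkp V) _ kap_fun kap_fun_linear.

Let kap : 'Hom(V, F V) := linfun kap_fun.

Let kap_inv_fun (q : frob pcharkp V) : V := r2v (frob_coord q).

Let kap_inv_fun_linear : linear kap_inv_fun.
Proof.
move=> c u v; rewrite /kap_inv_fun -linearP; congr r2v; apply/rowP => i.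
by rewrite !mxE /= linearP.
Qed.

HB.instance Definition _ :=
  GRing.isLinear.Build k (frob pcharkp V) V _ kap_inv_fun kap_inv_fun_linear.

Let kap_inv : 'Hom(F V, V) := linfun kap_inv_fun.

Let coord_kap (v : V) i : frob_coord (kap_fun v) 0 i = v2r v 0 i.
Proof. by rewrite mxE /= mcoeff_frob. Qed.

Let frob_coord_inj : injective (@frob_coord k p pcharkp V).
Proof.
move=> q r; have [g _ Kg] := @frob_pow_bij V; rewrite -(Kg q) -(Kg r) => /rowP h.
congr frob_pow; apply: (can_inj v2rK); apply/rowP => i; apply: (fmorph_inj phi).
have := h i; rewrite !frob_coord_pow; exact.
Qed.

Let kapK : (kap_inv \o kap)%VF = \1%VF.
Proof.
apply/lfunP => v; rewrite comp_lfunE !lfunE /= /kap_inv_fun.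
by rewrite -[RHS]v2rK; congr r2v; apply/rowP => i; rewrite coord_kap.
Qed.

Let kap_invK : (kap \o kap_inv)%VF = \1%VF.
Proof.
apply/lfunP => q; rewrite comp_lfunE !lfunE; apply: frob_coord_inj.
by apply/rowP => i; rewrite coord_kap r2vK.
Qed.

(** Write the image of v as u^p, so that v_i = u_i^p. The p-th powers of the coordinates of u A are
    the coordinates of v A, because the entries of A are their own p-th powers. *)
Let kap_comm (A : 'M[k]_m) : map_mx phi A = A ->
  (kap \o (Hom (rmulmx k A) : 'Hom(V, V)) = frob_map pcharkp (Hom (rmulmx k A) : 'Hom(V, V)) \o kap)%VF.
Proof.
move=> hA; set g := (Hom _ : 'Hom(V, V)); apply/lfunP => v.
rewrite !comp_lfunE (lfunE kap_fun) (lfunE kap_fun) /=.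
have [h _ Kh] := @frob_pow_bij V; pose u := h (kap_fun v).
have hu : kap_fun v = frob_pow u by rewrite Kh.
have vu i : v2r v 0 i = v2r u 0 i ^+ p by rewrite -coord_kap hu frob_coord_pow.
rewrite hu frob_map_pow; apply: frob_coord_inj; apply/rowP => i.
rewrite coord_kap frob_coord_pow !f2mxE -phiE.
have -> : v2r v = map_mx phi (v2r u) by apply/rowP => l; rewrite mxE phiE.
have hg : map_mx phi (f2mx g) = f2mx g by rewrite -[f2mx g]/(rmulmx k A) map_rmulmx hA.
by rewrite -{1}hg -map_mxM mxE.
Qed.

Let kap_mx (v : 'rV[k]_(dim (P V))) : 'rV[k]_(dim (pfcomp P F V)) :=
  v2r (pf_map P kap (r2v v)).

(** Apply P to [kap_comm]: the matrices [restr] come from integers, so Frobenius fixes them. *)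
Lemma quot_basis_comp_frob d e j n (w : 'I_n -> const_cochains m P) :
  has_degree P d -> has_degree (pfcomp P F) e ->
  quot_basis (const_cocycle j) (const_coboundary j) w ->
  exists w' : 'I_n -> const_cochains m (pfcomp P F),
    quot_basis (const_cocycle j) (const_coboundary j) w'.
Proof.
move=> hd he; apply: (quot_basis_transport hd he (sigma := idfun) (th := kap_mx)).
- by move=> y; exists y.
- by move=> x y; rewrite /kap_mx !linearD.
- by move=> c x; rewrite /kap_mx !linearZ.
- exists (fun v => v2r (pf_map P kap_inv (r2v v))) => v; rewrite /kap_mx v2rK -comp_lfunE -pf_comp.
    by rewrite kapK pf_id id_lfunE r2vK.
  by rewrite kap_invK pf_id id_lfunE r2vK.
move=> I a v; rewrite !pfmE /kap_mx v2rK; congr v2r.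
set g := (Hom _ : 'Hom(V, V)).
rewrite v2rK -!comp_lfunE -[pf_map (pfcomp P F) g]/(pf_map P (pf_map F g)) -!pf_comp.
by rewrite kap_comm // map_restr.
Qed.

End Functor.
End Comparison.

Unset Implicit Arguments.

Theorem theorem4p4 (k : closedFieldType) (p : nat) (pcharkp : p \in [pchar k])
    (d : nat) (P : polyFunctor k) (degP : has_degree P d)
    (n : nat) (n_gt0 : (0 < n)%N) (le_dp_n : (d * p <= n.-1)%N) (j : nat) :
  let Omega := cotangent k n.-1 in
  let F := frobenius pcharkp in
  lmod_iso (cohomology (pf_bundle (pfcomp F P) Omega) j)
           (cohomology (pf_bundle (pfcomp P F) Omega) j) /\
  lmod_iso (cohomology (pf_bundle (pfcomp P F) Omega) j)
           (cohomology (pf_bundle P Omega) j).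
Proof.
move=> Omega F.
have le_d : (d <= n.-1)%N.
  by apply: leq_trans le_dp_n; rewrite leq_pmulr // prime_gt0 // (pcharf_prime pcharkp).
have degPF := degree_comp degP (frobenius_degree pcharkp).
have degFP := degree_comp (frobenius_degree pcharkp) degP; rewrite mulnC in degFP.
(* [r] becomes the common size of the bases of all three cohomology spaces. *)
have [r [w hw]] := quot_basis_exists (const_cocycle0 n.-1 P j)
  (@const_cocycle_lin k n.-1 P j) (const_coboundary0 n.-1 P j)
  (@const_coboundary_lin k n.-1 P j) (fun v (h : const_coboundary j v) => h.1).
have [w1 hw1] := quot_basis_comp_frob degP degPF hw.
have [w2 hw2] := quot_basis_frob_comp degP degFP hw.
have [b hb] := cohomology_basis degP le_d hw.
have [b1 hb1] := cohomology_basis degPF le_dp_n hw1.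
have [b2 hb2] := cohomology_basis degFP le_dp_n hw2.
by split; [exact: lmod_iso_bases hb2 hb1 | exact: lmod_iso_bases hb1 hb].
Qed.
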